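(* Let $n\geq 1$. For any pattern $\tau$ (i.e. any permutation $\tau$), there exists a bijection $\Phi$ between $\mathcal{I}_n(123\oplus\tau)$ and $\mathcal{I}_n(321\oplus\tau)$ such that for every $\pi\in\mathcal{I}_n(123\oplus\tau)$ we have $\mathrm{Peak}(\pi)=\mathrm{Peak}(\Phi(\pi))$.
   Context: Permutations of $[n]=\{1,\ldots,n\}$ are written in one-line notation $\pi=\pi_1\pi_2\cdots\pi_n$. A permutation is an involution if $\pi=\pi^{-1}$. A permutation $\pi$ contains a permutation (pattern) $\sigma$ if some subsequence of $\pi$ is order isomorphic to $\sigma$; otherwise $\pi$ avoids $\sigma$. $\mathcal{I}_n(\sigma)$ denotes the set of involutions of $[n]$ that avoid $\sigma$. The direct sum of $\pi=\pi_1\cdots\pi_k\in\mathcal{S}_k$ and $\tau=\tau_1\cdots\tau_m\in\mathcal{S}_m$ is the permutation $\pi\oplus\tau=\pi_1\cdots\pi_k(\tau_1+k)(\tau_2+k)\cdots(\tau_m+k)$. An index $i$ with $1<i<n$ is a peak of $\pi$ if $\pi_{i-1}<\pi_i>\pi_{i+1}$; $\mathrm{Peak}(\pi)$ is the set of peaks of $\pi$. *)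

(* Defs.v *)
From mathcomp Require Import all_boot all_fingroup.
Set Implicit Arguments.
Unset Strict Implicit.
Unset Printing Implicit Defensive.

(* Permutations of [n] = {1, ..., n} are elements of 'S_n, with positions and
   values shifted down by one, so that both range over 'I_n = {0, ..., n-1}. *)

Definition contains (n k : nat) (p : 'S_n) (s : 'S_k) : bool :=
  [exists f : {ffun 'I_k -> 'I_n},
     [forall i : 'I_k, forall j : 'I_k, (i < j) ==> (f i < f j)] &&
     [forall i : 'I_k, forall j : 'I_k, (p (f i) < p (f j)) == (s i < s j)]].

Definition involution (n : nat) (p : 'S_n) : bool := p == (p^-1)%g.

Definition avoiding_involutions (n k : nat) (s : 'S_k) : {set 'S_n} :=
  [set p | involution p && ~~ contains p s].

Definition dsum_fun (k m : nat) (s : 'S_k) (t : 'S_m) (i : 'I_(k + m)) :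
    'I_(k + m) :=
  match split i with
  | inl a => lshift m (s a)
  | inr b => rshift k (t b)
  end.

Lemma dsum_fun_inj (k m : nat) (s : 'S_k) (t : 'S_m) :
  injective (dsum_fun s t).
Proof.
move=> i j eq_ij; apply: (can_inj (@splitK k m)); move: eq_ij.
rewrite /dsum_fun; case: (split i) => a; case: (split j) => b.
- by move=> /lshift_inj /perm_inj ->.
- by move/eqP; rewrite eq_lrshift.
- by move/eqP; rewrite eq_rlshift.
- by move=> /rshift_inj /perm_inj ->.
Qed.

Definition dsum (k m : nat) (s : 'S_k) (t : 'S_m) : 'S_(k + m) :=
  perm (@dsum_fun_inj k m s t).

Definition pat123 : 'S_3 := 1%g.
Definition pat321 : 'S_3 := perm (@rev_ord_inj 3).

(* The neighbours a and b of i both exist in 'I_n exactly when i is neither the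
   first nor the last position. *)
Definition Peak (n : nat) (p : 'S_n) : {set 'I_n} :=
  [set i : 'I_n | [exists a : 'I_n, exists b : 'I_n,
     [&& a.+1 == i, i.+1 == b, p a < p i & p b < p i]]].

(* Main.v *)
(* An involution avoids s (+) tau, for s = 123 or 321, iff its restriction to the
   board of those cells that have a copy of tau or of its inverse to their
   north-east avoids s. The part outside of the board determines the board, so
   only the filling of the board has to be changed. Fomin growth diagrams encode
   the 321-avoiding (resp. 123-avoiding) fillings bijectively by the sequences of
   partitions with at most two rows (resp. columns) along the border of the
   board. Peaks depend only on runs of consecutive columns of equal height with
   points on the board: where the height drops, the next point is above the
   board. In a run, with U (D) for adding a box to the first (second) row or
   column, a peak at the i-th column means UD at columns i, i+1 for 321-avoiding
   fillings and UD at columns i-1, i for 123-avoiding ones. So it suffices to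
   shift every run by one step while keeping its end points and the condition
   that the first row (column) is at least as long as the second. This gives a
   peak-preserving injection from the 321-side to the 123-side, and reading the
   same border data by the other rule gives an injection back. *)
Require Import Defs.
From mathcomp Require Import all_boot all_fingroup.
From mathcomp Require Import zify.
From Stdlib Require Import FunctionalExtensionality.

Set Implicit Arguments.
Unset Strict Implicit.
Unset Printing Implicit Defensive.

(** * Local rules *)

(* A state (p, q) with q <= p is a partition: its two rows if r = true, its two
   columns if r = false; in both cases (p.+1, q) and (p, q.+1) add a box. *)
Definition box_step (p q p' q' : nat) : Prop :=
  (p' = p /\ q' = q) \/ (p' = p.+1 /\ q' = q) \/ (p' = p /\ q' = q.+1).

(* Fomin's rule for a unit cell with south-west, north-west, south-east and
   north-east corners o, a, b, c, containing a point iff x. Configurations that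
   would need a third row (r = true) or a third column (r = false) are
   excluded, and this is what encodes pattern avoidance. *)
Definition local_rule (r x : bool) (po qo pa qa pb qb pc qc : nat) : Prop :=
  if x then
    (pa = po /\ qa = qo) /\ (pb = po /\ qb = qo) /\
    (if r then pc = po.+1 /\ qc = qo
     else qo = 0 /\ (po = 0 /\ pc = 1 /\ qc = 0 \/
                     0 < po /\ pc = po /\ qc = 1))
  else
    (pa = po /\ qa = qo /\ pc = pb /\ qc = qb) \/
    (pb = po /\ qb = qo /\ pc = pa /\ qc = qa) \/
    (pa + pb = po + po.+1 /\ qa + qb = qo + qo.+1 /\
     pc = po.+1 /\ qc = qo.+1) \/
    (pa = po.+1 /\ qa = qo /\ pb = po.+1 /\ qb = qo /\
     if r then pc = po.+1 /\ qc = qo.+1 else pc = po.+2 /\ qc = qo) \/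
    (~~ r /\ pa = po /\ qa = qo.+1 /\ pb = po /\ qb = qo.+1 /\
     (po < qo.+2 /\ pc = po.+1 /\ qc = qo.+1 \/
      qo.+2 <= po /\ pc = po /\ qc = qo.+2)).

Definition cell (r x : bool) (P Q : nat -> nat -> nat) (i j : nat) : Prop :=
  [/\ Q i j <= P i j, Q i j.+1 <= P i j.+1, Q i.+1 j <= P i.+1 j &
      Q i.+1 j.+1 <= P i.+1 j.+1] /\
  [/\ box_step (P i j) (Q i j) (P i j.+1) (Q i j.+1),
      box_step (P i j) (Q i j) (P i.+1 j) (Q i.+1 j) &
      local_rule r x (P i j) (Q i j) (P i j.+1) (Q i j.+1)
        (P i.+1 j) (Q i.+1 j) (P i.+1 j.+1) (Q i.+1 j.+1)].

(** The local rule solved for the north-east corner. Values on excluded configurations are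
    arbitrary; the last two hypotheses of [local_rule_forward] rule these out. *)
Definition forward (r x : bool) (o a b : nat * nat) : nat * nat :=
  if x then
    if r then (o.1.+1, o.2) else if o.1 == 0 then (1, 0) else (o.1, o.2.+1)
  else if a == o then b
  else if b == o then a
  else if a != b then (o.1.+1, o.2.+1)
  else if a.1 == o.1.+1 then (if r then (o.1.+1, o.2.+1) else (o.1.+2, o.2))
  else if o.1 < o.2.+2 then (o.1.+1, o.2.+1) else (o.1, o.2.+2).

(** For equal [a] and [b], the box by which [c] exceeds [a] lies in the first row of the diagram iff
    the cell has a point; otherwise [o] is [a] without the last box of the row above. For
    [r = false] the pairs list columns, so this row is found by comparing entries. *)
Definition backward (r : bool) (a b c : nat * nat) : bool * (nat * nat) :=
  if a == c then (false, b)
  else if b == c then (false, a)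
  else if a != b then (false, (c.1.-1, c.2.-1))
  else if c.1 == a.1.+1 then
    if r then (true, a)
    else if a.2 < a.1 then (false, (a.1.-1, a.2))
    else if a.1 == 0 then (true, a) else (false, (a.1, a.2.-1))
  else if r then (false, (a.1.-1, a.2))
  else if a.2 == 0 then (true, a) else (false, (a.1, a.2.-1)).

Lemma local_rule_forward (r x : bool) (o a b : nat * nat) :
  o.2 <= o.1 -> a.2 <= a.1 -> b.2 <= b.1 ->
  box_step o.1 o.2 a.1 a.2 -> box_step o.1 o.2 b.1 b.2 ->
  (x -> [/\ a = o, b = o & ~~ r -> o.2 = 0]) ->
  (~~ x -> r -> ~ (a = (o.1, o.2.+1) /\ b = (o.1, o.2.+1))) ->
  let c := forward r x o a b in
  local_rule r x o.1 o.2 a.1 a.2 b.1 b.2 c.1 c.2 /\ c.2 <= c.1.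
Proof.
case: o a b => [po qo] [pa qa] [pb qb] /= ho ha hb sa sb hx hnx.
rewrite /local_rule /forward /= !xpair_eqE.
case: x hx hnx => hx hnx.
  have {hx} [//|[-> ->] [-> ->] h] := hx.
  case: r {hnx} h => h /=; first by split=> //; lia.
  by move: (h isT) => ->; case: eqP => /=; lia.
case: r hnx {hx} => hnx;
  case: sa ha hnx => [[-> ->]|[[-> ->]|[-> ->]]] ha;
  case: sb hb => [[-> ->]|[[-> ->]|[-> ->]]] hb hnx;
  do ?[case: ifP => /= ?]; first [lia | by case: (hnx isT isT)].
Qed.

Lemma local_rule_forward_inj r x po qo pa qa pb qb pc qc pc' qc' :
  local_rule r x po qo pa qa pb qb pc qc ->
  local_rule r x po qo pa qa pb qb pc' qc' -> pc = pc' /\ qc = qc'.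
Proof. by rewrite /local_rule; case: r; case: x => /=; lia. Qed.

Lemma local_rule_backwardK (r x : bool) po qo pa qa pb qb pc qc :
  qo <= po -> qa <= pa -> qb <= pb ->
  box_step po qo pa qa -> box_step po qo pb qb ->
  local_rule r x po qo pa qa pb qb pc qc ->
  backward r (pa, qa) (pb, qb) (pc, qc) = (x, (po, qo)).
Proof.
move=> ho ha hb sa sb; rewrite /backward /local_rule !xpair_eqE /=.
case: sa ha => [[-> ->]|[[-> ->]|[-> ->]]] ha;
  case: sb hb => [[-> ->]|[[-> ->]|[-> ->]]] hb;
  case: x; case: r => /= hc; do ?[case: ifP => /= ?];
  congr (_, (_, _)); lia.
Qed.

Lemma local_rule_backward r a b c :
  a.2 <= a.1 -> b.2 <= b.1 -> c.2 <= c.1 ->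
  box_step a.1 a.2 c.1 c.2 -> box_step b.1 b.2 c.1 c.2 ->
  let xo := backward r a b c in
  [/\ xo.2.2 <= xo.2.1, box_step xo.2.1 xo.2.2 a.1 a.2,
      box_step xo.2.1 xo.2.2 b.1 b.2 &
      local_rule r xo.1 xo.2.1 xo.2.2 a.1 a.2 b.1 b.2 c.1 c.2].
Proof.
case: a b c => [pa qa] [pb qb] [pc qc] /= ha hb hc sa sb.
rewrite /backward /= !xpair_eqE /box_step /local_rule.
case: sa hc sb => [[-> ->]|[[-> ->]|[-> ->]]] hc;
  case=> [[hp hq]|[[hp hq]|[hp hq]]]; case: r => /=;
  do ?[case: ifP => /= ?]; split; lia.
Qed.

(** The last equation makes the size [p + q] of a state count the points to its south-west. *)
Lemma local_rule_step r x po qo pa qa pb qb pc qc :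
  box_step po qo pa qa -> box_step po qo pb qb ->
  local_rule r x po qo pa qa pb qb pc qc ->
  [/\ box_step pa qa pc qc, box_step pb qb pc qc &
      pc + qc + (po + qo) = pa + qa + (pb + qb) + x].
Proof.
rewrite /local_rule /box_step.
move=> sa sb; case: sa => [[-> ->]|[[-> ->]|[-> ->]]];
  case: sb => [[-> ->]|[[-> ->]|[-> ->]]]; case: r; case: x => /= *; split; lia.
Qed.

(** * Growth diagrams on a board *)

Ltac split_lia :=
  repeat match goal with
    | H : _ \/ _ |- _ => destruct H
    | H : _ /\ _ |- _ => destruct H
  end; lia.

Definition down_closed (L : nat -> nat -> bool) : Prop :=
  forall i j i' j', i' <= i -> j' <= j -> L i j -> L i' j'.

Definition flip (T : Type) (f : nat -> nat -> T) (i j : nat) : T := f j i.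

(* L is a set of lattice points; the unit cell with south-west corner (i, j)
   belongs to the board iff L i.+1 j.+1. *)
Definition growth (r : bool) (L X : nat -> nat -> bool)
    (P Q : nat -> nat -> nat) : Prop :=
  [/\ forall i, L i 0 -> P i 0 = 0 /\ Q i 0 = 0,
      forall j, L 0 j -> P 0 j = 0 /\ Q 0 j = 0 &
      forall i j, L i.+1 j.+1 -> cell r (X i j) P Q i j].

Definition partial_matching (X : nat -> nat -> bool) : Prop :=
  (forall i j j', X i j -> X i j' -> j = j') /\
  (forall i i' j, X i j -> X i' j -> i = i').

(* r = true: 321; r = false: 123. *)
Definition avoids_on (r : bool) (L X : nat -> nat -> bool) : Prop :=
  forall x u i y v j, x < u < i -> y < v < j ->
    (if r then X x j && X i y else X x y && X i j) -> X u v -> ~~ L i.+1 j.+1.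

Lemma local_rule_flip r x po qo pa qa pb qb pc qc :
  local_rule r x po qo pa qa pb qb pc qc ->
  local_rule r x po qo pb qb pa qa pc qc.
Proof.
rewrite /local_rule; case: x => /=; first by case=> ? [? ?].
case=> [h|[h|[h|[h|h]]]]; [by right; left|by left| | |].
- by do 2 right; left; case: h => ? [? ?]; rewrite addnC [qb + _]addnC.
- by do 3 right; left; case: h => ? [? [? [? ?]]].
- by do 4 right; case: h => ? [? [? [? [? ?]]]].
Qed.

Lemma down_closed_flip L : down_closed L -> down_closed (flip L).
Proof. by move=> dL i j i' j' hi hj; exact: dL. Qed.

(** Gives the row versions of all column lemmas by transposing the diagram. *)
Lemma growth_flip r L X P Q :
  growth r L X P Q -> growth r (flip L) (flip X) (flip P) (flip Q).
Proof.
move=> [h0 h1 h]; split=> // i j Lij.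
have [[? ? ? ?] [? ? hr]] := h j i Lij.
by split; split=> //; exact: local_rule_flip.
Qed.

Lemma growth_sub r (L L' : nat -> nat -> bool) X P Q :
  (forall i j, L' i j -> L i j) -> growth r L X P Q -> growth r L' X P Q.
Proof. by move=> s [h0 h1 h]; split=> *; [apply: h0|apply: h1|apply: h]; exact: s. Qed.

Section Growth.
Variables (r : bool) (L X : nat -> nat -> bool) (P Q : nat -> nat -> nat).
Hypotheses (dL : down_closed L) (g : growth r L X P Q).

Let axis0 i : L i 0 -> P i 0 = 0 /\ Q i 0 = 0. Proof. by case: g => h _ _; exact: h. Qed.
Let axis1 j : L 0 j -> P 0 j = 0 /\ Q 0 j = 0. Proof. by case: g => _ h _; exact: h. Qed.
Let gcell i j : L i.+1 j.+1 -> cell r (X i j) P Q i j.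
Proof. by case: g => _ _ h; exact: h. Qed.

Lemma growth_le i j : L i j -> Q i j <= P i j.
Proof.
case: i j => [|i] [|j] h.
- by have [-> ->] := axis0 h.
- by have [-> ->] := axis1 h.
- by have [-> ->] := axis0 h.
- by have [[]] := gcell h.
Qed.

Lemma growth_step_up i j :
  L i j.+1 -> box_step (P i j) (Q i j) (P i j.+1) (Q i j.+1).
Proof.
case: i => [|i] h; last first.
  by have [_ [sa sb hr]] := gcell h; have [] := local_rule_step sa sb hr.
have h' : L 0 j by apply: dL h.
by have [-> ->] := axis1 h; have [-> ->] := axis1 h'; left.
Qed.

Lemma growth_step_right i j :
  L i.+1 j -> box_step (P i j) (Q i j) (P i.+1 j) (Q i.+1 j).
Proof.
case: j => [|j] h; last first.
  by have [_ [sa sb hr]] := gcell h; have [] := local_rule_step sa sb hr.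
have h' : L i 0 by apply: dL h.
by have [-> ->] := axis0 h; have [-> ->] := axis0 h'; left.
Qed.

Lemma growth_mono i j i' j' : i <= i' -> j <= j' -> L i' j' ->
  P i j <= P i' j' /\ Q i j <= Q i' j'.
Proof.
move=> /subnKC <- /subnKC <-; elim: (i' - i) => [|k IH].
  rewrite addn0; elim: (j' - j) => [|l IH]; first by rewrite addn0.
  rewrite addnS => h; have := growth_step_up h.
  by have := IH (dL (leqnn _) (leqnSn _) h); rewrite /box_step; lia.
rewrite addnS => h; have := growth_step_right h.
by have := IH (dL (leqnSn _) (leqnn _) h); rewrite /box_step; lia.
Qed.

Lemma growth_size_col i j : L i.+1 j ->
  P i.+1 j + Q i.+1 j = P i j + Q i j + has (X i) (iota 0 j).
Proof.
elim: j => [|j IH] h.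
  have h' : L i 0 by apply: dL h.
  by have [-> ->] := axis0 h; have [-> ->] := axis0 h'.
have {}IH := IH (dL (leqnn _) (leqnSn _) h).
have [_ [sa sb hr]] := gcell h; have [s1 s2 e] := local_rule_step sa sb hr.
have -> : iota 0 j.+1 = iota 0 j ++ [:: j] by rewrite -[j.+1]addn1 iotaD.
rewrite has_cat /= orbF.
move: sa s1 IH e; rewrite /box_step.
by case: (has _ _); case: (X i j) => /=; lia.
Qed.

(** A lower point makes every higher step across the column add a box, whereas a cell with a point
    needs equal states at both ends of its lower edge. *)
Lemma growth_col_uniq i j j' :
  L i.+1 j.+1 -> L i.+1 j'.+1 -> X i j -> X i j' -> j = j'.
Proof.
wlog lt : j j' / j < j' => [W h h' x x'|h h' x x'].
  by case: (ltngtP j j') => // l; [apply: W|apply/esym; apply: W].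
have := growth_size_col (dL (leqnn _) (leqnSn _) h').
have -> : has (X i) (iota 0 j').
  by apply/hasP; exists j => //; rewrite mem_iota.
by have [_ [_ _]] := gcell h'; rewrite x' /local_rule; lia.
Qed.

Lemma growth_point i j : L i j -> 0 < P i j -> exists u v, [/\ u < i, v < j & X u v].
Proof.
have [n] := ubnP (i + j); elim: n i j => // n IH [|i] [|j] //= hn h.
- by have [->] := axis0 h.
- by have [->] := axis1 h.
- by have [->] := axis0 h.
move=> p0; have [[_ la lb _] [sa sb hr]] := gcell h.
case x: (X i j) hr => hr; first by exists i, j; split.
have [pa|pa] := posnP (P i j.+1).
  have pb : 0 < P i.+1 j.
    move: sa sb hr la p0; rewrite /box_step /local_rule; case: (r) => /= *;
      split_lia.
  have [|u [v [hu hv hx]]] := IH i.+1 j _ (dL (leqnn _) (leqnSn _) h) pb; first by lia.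
  by exists u, v; split; lia.
have [|u [v [hu hv hx]]] := IH i j.+1 _ (dL (leqnSn _) (leqnn _) h) pa; first by lia.
by exists u, v; split; lia.
Qed.

End Growth.

Lemma growth_size_row r L X P Q : down_closed L -> growth r L X P Q ->
  forall i j, L i j.+1 ->
  P i j.+1 + Q i j.+1 = P i j + Q i j + has (X^~ j) (iota 0 i).
Proof.
move=> dL /growth_flip g i j.
by move/(growth_size_col (down_closed_flip dL) g).
Qed.

Lemma growth_row_uniq r L X P Q : down_closed L -> growth r L X P Q ->
  forall i i' j, L i.+1 j.+1 -> L i'.+1 j.+1 -> X i j -> X i' j -> i = i'.
Proof.
move=> dL /growth_flip g i i' j.
by move/(growth_col_uniq (down_closed_flip dL) g); exact.
Qed.

(** * Growth diagrams and pattern avoidance *)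

Section Rows.
Variables (L X : nat -> nat -> bool) (P Q : nat -> nat -> nat).
Hypotheses (dL : down_closed L) (g : growth true L X P Q).

Lemma rows_corner u v : X u v -> L u.+1 v.+1 -> P u.+1 v.+1 = (P u v).+1.
Proof.
by case: g => _ _ h x /h [_ [_ _]]; rewrite x /local_rule => -[_ [_ []]].
Qed.

(** [P i j] is the length of a longest increasing chain in the rectangle, and [(u, v)] is the last
    point of one. Without a point in the corner cell, the value is inherited from a neighbour. *)
Lemma rows_point i j : L i j -> 0 < P i j ->
  exists u v, [/\ u < i, v < j, X u v & (P u v).+1 = P i j].
Proof.
have [n] := ubnP (i + j); elim: n i j => // n IH [|i] [|j] //= hn h.
- by case: g => h0 _ _; have [->] := h0 _ h.
- by case: g => _ h0 _; have [->] := h0 _ h.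
- by case: g => h0 _ _; have [->] := h0 _ h.
move=> p0; have [_ _ gcell] := g; have [_ [sa sb hr]] := gcell _ _ h.
case x: (X i j) hr => hr.
  by exists i, j; split=> //; rewrite (rows_corner x h).
have [e|e] : P i.+1 j.+1 = P i j.+1 \/ P i.+1 j.+1 = P i.+1 j.
  by move: sa sb hr; rewrite /box_step /local_rule => *; split_lia.
- have hl : L i j.+1 by apply: dL h.
  rewrite e in p0; have hn' : i + j.+1 < n by lia.
  have [u [v [hu hv hx he]]] := IH _ _ hn' hl p0.
  by exists u, v; split=> //; lia.
- have hl : L i.+1 j by apply: dL h.
  rewrite e in p0; have hn' : i.+1 + j < n by lia.
  have [u [v [hu hv hx he]]] := IH _ _ hn' hl p0.
  by exists u, v; split=> //; lia.
Qed.

(** A longest chain of the taller rectangle that uses row [j] ends at [(x, j)]. Its previous point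
    lies below height [v], since the strip between [v] and [j] is empty to the left of [u]; so
    [(u, v)] can replace [(x, j)]. *)
Lemma rows_321_up x u i y v j : L i.+1 j.+1 -> x < u < i -> y < v < j ->
  X x j -> X u v -> (forall s t, s < u -> v < t < j -> ~~ X s t) ->
  P i j.+1 <= P i j.
Proof.
move=> h /andP[xu ui] /andP[yv vj] xj uv no.
have hi : L i j.+1 by apply: dL h.
have mono s t s' t' : s <= s' -> t <= t' -> L s' t' -> P s t <= P s' t'.
  by move=> *; have [] := growth_mono dL g (i := s) (j := t) (i' := s') (j' := t').
have [->//|p0] := posnP (P i j.+1).
have [s [t [si tj st e]]] := rows_point hi p0.
have hp : P u.+1 v.+1 = (P u v).+1 by apply: rows_corner => //; apply: dL h; lia.
have hq : P u.+1 v.+1 <= P i j by apply: mono => //; apply: dL h.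
case: (ltngtP t j) => [lt|lt|lt]; [|by lia|]; last first.
  subst t; have {s si st e tj} e : (P x j).+1 = P i j.+1.
    suff -> : x = s by [].
    by apply: (growth_row_uniq dL g _ _ xj st); apply: dL h; lia.
  have hx : L x j by apply: dL h; lia.
  have [z|px] := posnP (P x j); first by lia.
  have [s [t [sx tj st e']]] := rows_point hx px.
  have hs : P s.+1 t.+1 = (P s t).+1 by apply: rows_corner => //; apply: dL h; lia.
  case: (ltngtP t v) => tv.
  - have : P s.+1 t.+1 <= P u v by apply: mono; [lia|lia|apply: dL h; lia].
    by lia.
  - by have /negP[] := no s t (ltn_trans sx xu) (introT andP (conj tv tj)).
  - subst t; have : s = u by apply: (growth_row_uniq dL g _ _ st uv); apply: dL h; lia.
    by lia.
rewrite -e -(rows_corner st); last by apply: dL h; lia.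
by apply: mono => //; apply: dL h.
Qed.

End Rows.

(** Take a 321 with [i + j] minimal. Minimality supplies the empty strips for [rows_321_up] and its
    transpose, so both steps out of the south-west corner of cell [(i, j)] add a box to the second
    row, which the local rule excludes. *)
Lemma growth_rows_avoids L X P Q :
  down_closed L -> growth true L X P Q -> avoids_on true L X.
Proof.
move=> dL g x u i y v j; have [n] := ubnP (i + j).
elim: n x u i y v j => // n IH x u i y v j hn xui yvj /andP[xj iy] uv.
apply/negP => h; have ij : ~~ X i j.
  apply/negP => ij; suff : y = j by lia.
  by apply: (growth_col_uniq dL g _ _ iy ij); apply: dL h; lia.
have up : P i j.+1 <= P i j.
  apply: (rows_321_up dL g h xui yvj xj uv) => s t su vt.
  apply/negP => st.
  have := IH s u i y v t; rewrite st iy uv => /(_ _ _ _ isT isT) /negP; apply; try lia.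
  by apply: dL h; lia.
have right : P i.+1 j <= P i j.
  have gf := growth_flip g; have dLf := down_closed_flip dL.
  apply: (rows_321_up dLf gf h yvj xui iy uv) => s t su vt.
  apply/negP; rewrite /flip => st.
  have := IH x u t s v j; rewrite st xj uv => /(_ _ _ _ isT isT) /negP; apply; try lia.
  by apply: dL h; lia.
have [_ _ gcell] := g; have [_ [sa sb hr]] := gcell _ _ h.
have := growth_size_col dL g (dL i.+1 j.+1 i.+1 j (leqnn _) (leqnSn _) h).
have := growth_size_row dL g (dL i.+1 j.+1 i j.+1 (leqnSn _) (leqnn _) h).
have -> : has (X i) (iota 0 j) by apply/hasP; exists y; rewrite ?mem_iota//; lia.
have -> : has (X^~ j) (iota 0 i) by apply/hasP; exists x; rewrite ?mem_iota//; lia.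
move: sa sb hr; rewrite (negbTE ij) /box_step /local_rule /= => *; split_lia.
Qed.

(** The middle point of a 123 opens the second column, which stays nonempty by monotonicity, but a
    cell with a point needs it empty at its south-west corner. *)
Lemma growth_cols_avoids L X P Q :
  down_closed L -> growth false L X P Q -> avoids_on false L X.
Proof.
move=> dL g x u i y v j /andP[xu ui] /andP[yv vj] /andP[xy ij] uv.
apply/negP => h; have [_ _ gcell] := g.
have huv : L u.+1 v.+1 by apply: dL h; lia.
have hxy : L x.+1 y.+1 by apply: dL h; lia.
have [_ [_ _]] := gcell _ _ h; rewrite ij => -[_ [_ [q0 _]]].
have := gcell _ _ huv; rewrite uv => -[_ [_ _ [_ [_ [q1 hc]]]]].
have := gcell _ _ hxy; rewrite xy => -[_ [_ _ [_ [_ [q2 hc']]]]].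
have [] := growth_mono dL g xu yv (dL _ _ _ _ (leqnSn u) (leqnSn v) huv).
have [] := growth_mono dL g ui vj (dL _ _ _ _ (leqnSn i) (leqnSn j) h).
by lia.
Qed.

Lemma growth_avoids r L X P Q :
  down_closed L -> growth r L X P Q -> avoids_on r L X.
Proof. by case: r; [exact: growth_rows_avoids|exact: growth_cols_avoids]. Qed.

(* If both outer steps add a box to the second row, then no longest increasing
   chain of the rectangle can use only points left of x or only points below y,
   so its last point is the middle of a 321. *)
Lemma rows_no_321_step (L X : nat -> nat -> bool) (P Q : nat -> nat -> nat) i j :
  down_closed L -> growth true L X P Q -> partial_matching X ->
  L i j.+1 -> L i.+1 j ->
  P i j.+1 = P i j -> Q i j.+1 = (Q i j).+1 ->
  P i.+1 j = P i j -> Q i.+1 j = (Q i j).+1 ->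
  exists x u y v, [/\ x < u < i, y < v < j, X x j, X i y & X u v].
Proof.
move=> dL g [mc mr] ha hb pa qa pb qb.
have ho : L i j by apply: dL ha.
have mono s t s' t' : s <= s' -> t <= t' -> L s' t' -> P s t <= P s' t'.
  by move=> *; have [] := growth_mono dL g (i := s) (j := t) (i' := s') (j' := t').
have := growth_size_col dL g hb; have := growth_size_row dL g ha.
rewrite pa qa pb qb.
case: hasP => [[x]|_] /=; last by lia.
rewrite mem_iota => xi xj _.
case: hasP => [[y]|_] /=; last by lia.
rewrite mem_iota => yj iy _.
have px : P x.+1 j.+1 = (P x j).+1 by apply: (rows_corner g) => //; apply: dL ha; lia.
have py : P i.+1 y.+1 = (P i y).+1 by apply: (rows_corner g) => //; apply: dL hb; lia.
have lx : P x.+1 j.+1 <= P i j by rewrite -pa; apply: mono => //; lia.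
have ly : P i.+1 y.+1 <= P i j by rewrite -pb; apply: mono => //; lia.
have p0 : 0 < P i j by lia.
have [u [v [ui vj uv e]]] := rows_point dL g ho p0.
have puv : P u.+1 v.+1 = (P u v).+1 by apply: (rows_corner g) => //; apply: dL ho; lia.
exists x, u, y, v; split=> //.
- rewrite ui andbT; case: (ltngtP x u) => // xu.
    have : P u.+1 v.+1 <= P x j by apply: mono; [lia|lia|apply: dL ha; lia].
    by lia.
  by have := mc _ _ _ xj; rewrite xu => /(_ _ uv); lia.
- rewrite vj andbT; case: (ltngtP y v) => // yv.
    have : P u.+1 v.+1 <= P i y by apply: mono; [lia|lia|apply: dL hb; lia].
    by lia.
  by have := mr _ _ _ iy; rewrite yv => /(_ _ uv); lia.
Qed.

(** A point opens the second column only over a nonempty first one, hence with another point to its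
    south-west. A further point at [(i, j)] would complete a 123. *)
Lemma cols_point (L X : nat -> nat -> bool) (P Q : nat -> nat -> nat) i j :
  down_closed L -> growth false L X P Q -> L i j -> 0 < Q i j ->
  exists x u y v, [/\ x < u < i, y < v < j, X x y & X u v].
Proof.
move=> dL g; have [n] := ubnP (i + j); elim: n i j => // n IH [|i] [|j] //= hn h.
- by case: g => h0 _ _; have [_ ->] := h0 _ h.
- by case: g => _ h0 _; have [_ ->] := h0 _ h.
- by case: g => h0 _ _; have [_ ->] := h0 _ h.
move=> q0; have [_ _ gcell] := g; have [_ [sa sb hr]] := gcell _ _ h.
have ho : L i j by apply: dL h.
case x: (X i j) hr => hr.
  have p0 : 0 < P i j by move: hr; rewrite /local_rule; lia.
  have [s [t [si tj st]]] := growth_point dL g ho p0.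
  by exists s, i, t, j; split=> //; lia.
have [e|e] : 0 < Q i j.+1 \/ 0 < Q i.+1 j.
  by move: sa sb hr; rewrite /box_step /local_rule /= => *; split_lia.
- have hl : L i j.+1 by apply: dL h.
  have hn' : i + j.+1 < n by lia.
  have [s [u [t [v [hu hv hx he]]]]] := IH _ _ hn' hl e.
  by exists s, u, t, v; split=> //; lia.
- have hl : L i.+1 j by apply: dL h.
  have hn' : i.+1 + j < n by lia.
  have [s [u [t [v [hu hv hx he]]]]] := IH _ _ hn' hl e.
  by exists s, u, t, v; split=> //; lia.
Qed.

(** * Existence and uniqueness of the diagram of a filling *)

Fixpoint forward_growth (r : bool) (X : nat -> nat -> bool) (i : nat) : nat -> nat * nat :=
  if i is i'.+1 then
    fix col j := if j is j'.+1
      then forward r (X i' j') (forward_growth r X i' j') (forward_growth r X i' j) (col j')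
      else (0, 0)
  else fun=> (0, 0).

Lemma avoids_growth r L X :
  down_closed L -> partial_matching X -> avoids_on r L X ->
  exists P Q, growth r L X P Q.
Proof.
move=> dL pm av.
pose P i j := (forward_growth r X i j).1; pose Q i j := (forward_growth r X i j).2; exists P, Q.
(* Induction on antidiagonals: the part with [i + j <= m] is a board of its own, to which the lemmas
   on growth diagrams apply. *)
pose Lm m i j := L i j && (i + j <= m).
have dLm m : down_closed (Lm m).
  by move=> i j i' j' hi hj /andP[h hm]; rewrite /Lm (dL _ _ _ _ hi hj h); lia.
suff gm m : growth r (Lm m) X P Q.
  have [_ _ gcell] := gm 0.
  split=> [[]|[]|i j h] //; have [_ _] := gm (i.+1 + j.+1).
  by apply; rewrite /Lm h leqnn.
elim: m => [|m g]; first by split=> [[]|[]|i j /andP[_]] //; lia.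
split=> [[]|[]|i j /andP[h hm]] //.
have [le_m|lt_m] := leqP (i.+1 + j.+1) m.
  by case: g => _ _; apply; rewrite /Lm h.
have ho : Lm m i j by rewrite /Lm (dL _ _ _ _ (leqnSn i) (leqnSn j) h); lia.
have ha : Lm m i j.+1 by rewrite /Lm (dL _ _ _ _ (leqnSn i) (leqnn j.+1) h); lia.
have hb : Lm m i.+1 j by rewrite /Lm (dL _ _ _ _ (leqnn i.+1) (leqnSn j) h); lia.
have sa := growth_step_up (dLm m) g ha.
have sb := growth_step_right (dLm m) g hb.
have leo := growth_le g ho; have lea := growth_le g ha; have leb := growth_le g hb.
have [mc mr] := pm.
have fw := @local_rule_forward r (X i j) (forward_growth r X i j)
  (forward_growth r X i j.+1) (forward_growth r X i.+1 j) leo lea leb sa sb.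
have [||hr lec] := fw; last by split.
(* A point in the cell leaves no other one in its row or column, so by sizes neither outer step adds
   a box. *)
- move=> x; have := growth_size_col (dLm m) g hb; have := growth_size_row (dLm m) g ha.
  case: hasP => [[s]|_]; first by rewrite mem_iota => hs /mr /(_ x); lia.
  case: hasP => [[s]|_]; first by rewrite mem_iota => hs /mc /(_ x); lia.
  move=> ea eb; split.
  + rewrite [LHS]surjective_pairing [RHS]surjective_pairing; congr (_, _);
      by move: ea sa; rewrite /box_step /P /Q; lia.
  + rewrite [LHS]surjective_pairing [RHS]surjective_pairing; congr (_, _);
      by move: eb sb; rewrite /box_step /P /Q; lia.
  move=> /negbTE er; rewrite er in g av.
  have [q0|q0] := posnP (Q i j); first exact: q0.
  have [s [u [t [v [su tv st uv]]]]] := cols_point (dLm m) g ho q0.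
  by have := av s u i t v j su tv; rewrite st x uv h => /(_ isT isT).
- move=> nx er [ea eb]; rewrite er in g av.
  have [s [u [t [v [su tv sj it uv]]]]] := rows_no_321_step (dLm m) g pm ha hb
    (congr1 fst ea) (congr1 snd ea) (congr1 fst eb) (congr1 snd eb).
  by have := av s u i t v j su tv; rewrite sj it uv h => /(_ isT isT).
Qed.

Lemma growth_forward_uniq r L X P Q P' Q' : down_closed L ->
  growth r L X P Q -> growth r L X P' Q' ->
  forall i j, L i j -> P i j = P' i j /\ Q i j = Q' i j.
Proof.
move=> dL [a0 a1 ac] [b0 b1 bc] i j; have [n] := ubnP (i + j).
elim: n i j => // n IH [|i] [|j] hn h.
- by have [-> ->] := a0 _ h; have [-> ->] := b0 _ h.
- by have [-> ->] := a1 _ h; have [-> ->] := b1 _ h.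
- by have [-> ->] := a0 _ h; have [-> ->] := b0 _ h.
have [_ [_ _ r1]] := ac _ _ h; have [_ [_ _ r2]] := bc _ _ h.
have [|e1 e2] := IH i j _ (dL _ _ _ _ (leqnSn i) (leqnSn j) h); first by lia.
have [|e3 e4] := IH i j.+1 _ (dL _ _ _ _ (leqnSn i) (leqnn j.+1) h); first by lia.
have [|e5 e6] := IH i.+1 j _ (dL _ _ _ _ (leqnn i.+1) (leqnSn j) h); first by lia.
by apply: local_rule_forward_inj r2; rewrite -e1 -e2 -e3 -e4 -e5 -e6.
Qed.

(** * Reconstruction from the border *)

Definition border (L : nat -> nat -> bool) (i j : nat) : bool :=
  L i j && ~~ L i.+1 j.+1.

Definition bounded_by (n : nat) (L : nat -> nat -> bool) : Prop :=
  forall i j, L i j -> i <= n /\ j <= n.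

(** [backward] recovers the point and the south-west state of a cell from its other corners, so
    agreement spreads from the border inwards. The bound [n] provides the measure. *)
Lemma growth_backward_uniq n r L X X' P Q P' Q' :
  down_closed L -> bounded_by n L ->
  growth r L X P Q -> growth r L X' P' Q' ->
  (forall i j, border L i j -> P i j = P' i j /\ Q i j = Q' i j) ->
  (forall i j, L i j -> P i j = P' i j /\ Q i j = Q' i j) /\
  (forall i j, L i.+1 j.+1 -> X i j = X' i j).
Proof.
move=> dL bL [_ _ ac] [_ _ bc] eb.
have main i j : L i j -> (P i j = P' i j /\ Q i j = Q' i j) /\
    (L i.+1 j.+1 -> X i j = X' i j).
  have [k] := ubnP (n + n - (i + j)); elim: k i j => // k IH i j hk h.
  have [h1|h1] := boolP (L i.+1 j.+1); last first.
    by split=> //; apply: eb; rewrite /border h.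
  have [ni nj] := bL _ _ h1.
  have [[_ la lb _] [sa sb r1]] := ac _ _ h1.
  have [[lo _ _ _] [sa' sb' r2]] := bc _ _ h1.
  have [|[e1 e2] _] := IH i.+1 j.+1 _ h1; first by lia.
  have [|[e3 e4] _] := IH i j.+1 _ (dL _ _ _ _ (leqnSn i) (leqnn j.+1) h1); first by lia.
  have [|[e5 e6] _] := IH i.+1 j _ (dL _ _ _ _ (leqnn i.+1) (leqnSn j) h1); first by lia.
  have [[lo' _ _ _] _] := ac _ _ h1.
  have := local_rule_backwardK lo' la lb sa sb r1.
  rewrite e1 e2 e3 e4 e5 e6 in la lb *.
  by rewrite (local_rule_backwardK lo la lb sa' sb' r2) => -[-> -> ->].
split=> i j h; first by case: (main _ _ h).
by case: (main _ _ (dL _ _ _ _ (leqnSn i) (leqnSn j) h)) => _; apply.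
Qed.

(* k is fuel; it suffices once n + n <= i + j + k. *)
Fixpoint backward_growth (r : bool) (L : nat -> nat -> bool) (G : nat -> nat -> nat * nat)
    (k i j : nat) : bool * (nat * nat) :=
  if L i.+1 j.+1 then
    if k is k'.+1 then
      backward r (backward_growth r L G k' i j.+1).2 (backward_growth r L G k' i.+1 j).2
        (backward_growth r L G k' i.+1 j.+1).2
    else (false, (0, 0))
  else (false, G i j).

Lemma backward_growth_fuel n r L G k i j : bounded_by n L ->
  n + n <= i + j + k -> backward_growth r L G k.+1 i j = backward_growth r L G k i j.
Proof.
move=> bL; elim: k i j => [|k IH] i j hk.
  by rewrite /=; case: ifP => // /bL; lia.
rewrite [LHS]/= [RHS]/=; case: ifP => // h.
(* The induction hypothesis with its left side unfolded once, as simplification leaves it in the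
   goal. *)
have E i' j' : n + n <= i' + j' + k ->
  (if L i'.+1 j'.+1 then
    backward r (backward_growth r L G k i' j'.+1).2 (backward_growth r L G k i'.+1 j').2
        (backward_growth r L G k i'.+1 j'.+1).2
  else (false, G i' j')) = backward_growth r L G k i' j' by move/IH.
by rewrite !E //; lia.
Qed.

Definition border_path (L : nat -> nat -> bool) (P Q : nat -> nat -> nat) : Prop :=
  [/\ forall i j, border L i j -> Q i j <= P i j,
      forall i j, border L i j -> L i.+1 j ->
        box_step (P i j) (Q i j) (P i.+1 j) (Q i.+1 j),
      forall i j, border L i j -> L i j.+1 ->
        box_step (P i j) (Q i j) (P i j.+1) (Q i j.+1) &
      forall i j, border L i j -> i * j = 0 -> P i j + Q i j = 0].

(** By [local_rule_backward] the backward rule never gets stuck. The axes hold empty states because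
    states grow along them up to an empty one on the border. *)
Lemma border_path_growth n r L GP GQ :
  down_closed L -> bounded_by n L -> border_path L GP GQ ->
  exists X P Q, [/\ growth r L X P Q,
    forall i j, X i j -> L i.+1 j.+1 &
    forall i j, border L i j -> P i j = GP i j /\ Q i j = GQ i j].
Proof.
move=> dL bL [gle gright gup g0].
pose h := backward_growth r L (fun i j => (GP i j, GQ i j)) (n + n).
have hE i j : h i j = if L i.+1 j.+1
    then backward r (h i j.+1).2 (h i.+1 j).2 (h i.+1 j.+1).2
    else (false, (GP i j, GQ i j)).
  by rewrite {1}/h -(backward_growth_fuel _ _ bL) ?leq_addl //.
pose P i j := (h i j).2.1; pose Q i j := (h i j).2.2.
have hb i j : border L i j -> P i j = GP i j /\ Q i j = GQ i j.
  by move=> /andP[_ nL]; rewrite /P /Q hE (negbTE nL).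
have main i j : L i j -> [/\ Q i j <= P i j,
    L i.+1 j -> box_step (P i j) (Q i j) (P i.+1 j) (Q i.+1 j),
    L i j.+1 -> box_step (P i j) (Q i j) (P i j.+1) (Q i j.+1) &
    L i.+1 j.+1 -> cell r (h i j).1 P Q i j].
  have [k] := ubnP (n + n - (i + j)); elim: k i j => // k IH i j hk hL.
  have [h1|h1] := boolP (L i.+1 j.+1); last first.
    have bij : border L i j by rewrite /border hL.
    have [-> ->] := hb _ _ bij; split=> //; first exact: gle.
      move=> hr; have [|-> ->] := hb i.+1 j; last exact: gright.
      by rewrite /border hr; apply: contra h1; apply: dL.
    move=> hr; have [|-> ->] := hb i j.+1; last exact: gup.
    by rewrite /border hr; apply: contra h1; apply: dL.
  have [ni nj] := bL _ _ h1.
  have [|lc _ _ _] := IH i.+1 j.+1 _ h1; first by lia.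
  have [|la sa _ _] := IH i j.+1 _ (dL _ _ _ _ (leqnSn i) (leqnn j.+1) h1); first by lia.
  have [|lb _ sb _] := IH i.+1 j _ (dL _ _ _ _ (leqnn i.+1) (leqnSn j) h1); first by lia.
  have := local_rule_backward r la lb lc (sa h1) (sb h1).
  have -> : backward r (h i j.+1).2 (h i.+1 j).2 (h i.+1 j.+1).2 = h i j.
    by rewrite [RHS]hE h1.
  by move=> [lo ta tb hr]; split=> // _; split.
have axis1 j : L 0 j -> P 0 j = 0 /\ Q 0 j = 0.
  have [k] := ubnP (n - j); elim: k j => // k IH j hk h0.
  have [h1|h1] := boolP (L 0 j.+1); last first.
    have bj : border L 0 j by rewrite /border h0; apply: contra h1; apply: dL.
    by have := g0 _ _ bj; have [-> ->] := hb _ _ bj; lia.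
  have [_ nj] := bL _ _ h1; have [_ _ /(_ h1)] := main _ _ h0.
  by have [|-> ->] := IH j.+1 _ h1; rewrite /box_step; lia.
have axis0 i : L i 0 -> P i 0 = 0 /\ Q i 0 = 0.
  have [k] := ubnP (n - i); elim: k i => // k IH i hk h0.
  have [h1|h1] := boolP (L i.+1 0); last first.
    have bi : border L i 0 by rewrite /border h0; apply: contra h1; apply: dL.
    by have := g0 _ _ bi; rewrite muln0; have [-> ->] := hb _ _ bi; lia.
  have [ni _] := bL _ _ h1; have [_ /(_ h1)] := main _ _ h0.
  by have [|-> ->] := IH i.+1 _ h1; rewrite /box_step; lia.
exists (fun i j => L i.+1 j.+1 && (h i j).1), P, Q; split=> //; last by move=> i j /andP[].
split=> // i j h1; rewrite h1 /=.
by have [_ _ _] := main _ _ (dL _ _ _ _ (leqnSn i) (leqnSn j) h1); apply.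
Qed.

(** * Descents along the border *)

(** [P] measures longest chains. If [x < y], a chain that grows at column [i] ends at [(i, x)] and
    extends by [(i.+1, y)]. If [y < x], a longest chain left of column [i] extends by [(i, x)], for
    if it ended higher there would be a 321; a chain ending at [(i.+1, y)] is then not longer than
    one ending at [(i, x)]. *)
Lemma rows_descent L X P Q i j x y : down_closed L -> growth true L X P Q ->
  L i.+2 j -> X i x -> X i.+1 y -> x < j -> y < j ->
  (y < x) = (P i j < P i.+1 j) && (Q i.+1 j < Q i.+2 j).
Proof.
move=> dL g h ix iy xj yj; have av := growth_avoids dL g.
have h1 : L i.+1 j by apply: dL h.
have mono s t s' t' : s <= s' -> t <= t' -> L s' t' -> P s t <= P s' t'.
  by move=> *; have [] := growth_mono dL g (i := s) (j := t) (i' := s') (j' := t').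
have cx : P i.+1 x.+1 = (P i x).+1 by apply: (rows_corner g) => //; apply: dL h1.
have cy : P i.+2 y.+1 = (P i.+1 y).+1 by apply: (rows_corner g) => //; apply: dL h.
have lx : P i.+1 x.+1 <= P i.+1 j by apply: mono.
have ly : P i.+2 y.+1 <= P i.+2 j by apply: mono.
have := growth_size_col dL g h1; have := growth_size_col dL g h.
have -> : has (X i) (iota 0 j) by apply/hasP; exists x; rewrite ?mem_iota.
have -> : has (X i.+1) (iota 0 j) by apply/hasP; exists y; rewrite ?mem_iota.
have s1 := growth_step_right dL g h1; have s2 := growth_step_right dL g h.
have [u [v [ui vj uv e]]] : exists u v,
    [/\ u < i.+1, v < j, X u v & (P u v).+1 = P i.+1 j].
  by apply: (rows_point dL g h1); lia.
have huv : L u.+1 v.+1 by apply: dL h1; lia.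
have [u' [v' [ui' vj' uv' e']]] : exists u v,
    [/\ u < i.+2, v < j, X u v & (P u v).+1 = P i.+2 j].
  by apply: (rows_point dL g h); lia.
have uniq1 w : X i w -> w < j -> w = x.
  by move=> iw wj; apply: (growth_col_uniq dL g _ _ iw ix); apply: dL h1.
have uniq2 w : X i.+1 w -> w < j -> w = y.
  by move=> iw wj; apply: (growth_col_uniq dL g _ _ iw iy); apply: dL h.
move=> z1 z2; case: (ltngtP y x) => yx; last first.
- have := growth_row_uniq dL g (i := i) (i' := i.+1) (j := x).
  rewrite -{4}yx => /(_ _ _ ix iy).
  by rewrite (dL _ _ _ _ (leqnn _) xj h1) (dL _ _ _ _ (leqnn _) xj h); lia.
- apply/esym/negP => /andP[up down].
  have ei : u = i.
    case: (ltngtP u i) ui => // [ui _|]; last by lia.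
    have : P u.+1 v.+1 <= P i j by apply: mono => //; apply: dL h1.
    by rewrite (rows_corner g uv huv); lia.
  rewrite ei in uv e; have ev := uniq1 _ uv vj; rewrite ev in e.
  have : P i.+1 x.+1 <= P i.+1 y by apply: mono => //; apply: dL h1; lia.
  by move: s2; rewrite /box_step; lia.
- apply/esym/andP.
  have eyi : P i.+1 y = P i y.
    have hy : L i.+1 y by apply: dL h1; lia.
    have := growth_size_col dL g hy; have := growth_step_right dL g hy.
    case: hasP => [[w]|_] /=; last by rewrite /box_step; lia.
    rewrite mem_iota => wy iw.
    by have := uniq1 w iw; lia.
  have up : P i j < P i.+1 j.
    case: (ltnP (P i j)) => // le.
    have p0 : 0 < P i j by lia.
    have [s [t [si tj st es]]] := rows_point dL g (dL _ _ _ _ (leqnSn i) (leqnn j) h1) p0.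
    case: (ltngtP t x) => tx.
    + have : P s.+1 t.+1 <= P i x by apply: mono => //; apply: dL h1; lia.
      by rewrite (rows_corner g st); [lia|apply: dL h1; lia].
    + have := av s i i.+1 y x t; rewrite st iy ix => /(_ _ _ isT isT) /negP[]; try lia.
      by apply: dL h; lia.
    + rewrite tx in st; have := growth_row_uniq dL g _ _ st ix.
      by rewrite (dL _ _ _ _ _ xj h1) ?(dL _ _ _ _ _ xj h1); lia.
  split=> //; case: (ltngtP u' i.+1) ui' => [ui' _||eu _]; last first.
  + rewrite eu in uv' e'; have ev := uniq2 _ uv' vj'; rewrite ev in e'.
    have : P i y <= P i x by apply: mono; [lia|lia|apply: dL h1; lia].
    by move: s2; rewrite /box_step; lia.
  + by lia.
  + have : P u'.+1 v'.+1 <= P i.+1 j by apply: mono.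
    rewrite (rows_corner g uv'); last by apply: dL h; lia.
    by move: s2; rewrite /box_step; lia.
Qed.

(** Unprimed states lie on the lower edge of two adjacent cells without points, primed ones on the
    upper edge: UD is unchanged by a row above both points. *)
Lemma cols_ascent_stable p0 q0 p1 q1 p2 q2 p0' q0' p1' q1' p2' q2' :
  q0 <= p0 -> q1 <= p1 -> q2 <= p2 -> q0' <= p0' ->
  p1 + q1 = p0 + q0 + 1 -> p2 + q2 = p1 + q1 + 1 ->
  box_step p0 q0 p1 q1 -> box_step p1 q1 p2 q2 ->
  box_step p0 q0 p0' q0' -> box_step p1 q1 p1' q1' ->
  p1' + q1' = p0' + q0' + 1 -> p2' + q2' = p1' + q1' + 1 ->
  local_rule false false p0 q0 p0' q0' p1 q1 p1' q1' ->
  local_rule false false p1 q1 p1' q1' p2 q2 p2' q2' ->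
  ((p0' < p1') && (q1' < q2')) = ((p0 < p1) && (q1 < q2)).
Proof.
move=> l0 l1 l2 l0' z1 z2 s1 s2 t0.
case: s1 z1 l1 => [[-> ->]|[[-> ->]|[-> ->]]] z1 l1; first (by lia);
case: s2 z2 l2 => [[-> ->]|[[-> ->]|[-> ->]]] z2 l2; try (by lia);
case: t0 l0' => [[-> ->]|[[-> ->]|[-> ->]]] l0';
case=> [[-> ->]|[[-> ->]|[-> ->]]] y1; try (by lia); clear z1 z2;
rewrite /local_rule /= => y2 r1 r2; lia.
Qed.

(** The higher point is in the right column. The left column has already made the first column of
    the state nonempty, so this point opens the second. *)
Lemma cols_ascent_base_up p0 q0 p1 q1 p2 q2 p0' q0' p1' q1' p2' q2' :
  q0 <= p0 -> q1 <= p1 -> box_step p0 q0 p1 q1 -> box_step p0 q0 p0' q0' ->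
  p1 + q1 = p0 + q0 + 1 -> p1' + q1' = p0' + q0' + 1 ->
  local_rule false false p0 q0 p0' q0' p1 q1 p1' q1' ->
  local_rule false true p1 q1 p1' q1' p2 q2 p2' q2' ->
  (p0' < p1') && (q1' < q2').
Proof.
move=> l0 l1 s1 t0.
case: s1 l1 => [[-> ->]|[[-> ->]|[-> ->]]] l1;
case: t0 => [[-> ->]|[[-> ->]|[-> ->]]];
rewrite /local_rule /= => z1 z2 r1 r2; lia.
Qed.

Lemma cols_ascent_base_down p0 q0 p1 q1 p2 q2 p0' q0' p1' q1' p2' q2' :
  q1 <= p1 -> q2 <= p2 -> box_step p1 q1 p2 q2 ->
  p2 + q2 = p1 + q1 + 1 ->
  local_rule false true p0 q0 p0' q0' p1 q1 p1' q1' ->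
  local_rule false false p1 q1 p1' q1' p2 q2 p2' q2' ->
  ~~ ((p0' < p1') && (q1' < q2')).
Proof.
move=> l1 l2 s2.
case: s2 l2 => [[-> ->]|[[-> ->]|[-> ->]]];
rewrite /local_rule /= => l2 z1 r1 r2; lia.
Qed.

(** Induction on the height above the higher point. As in [rows_descent], this reads the descent set
    off the recording tableau of RSK. *)
Lemma cols_ascent L X P Q i j x y : down_closed L -> growth false L X P Q ->
  L i.+2 j -> X i x -> X i.+1 y -> x < j -> y < j ->
  (x < y) = (P i j < P i.+1 j) && (Q i.+1 j < Q i.+2 j).
Proof.
move=> dL g h ix iy xj yj; have [_ _ gcell] := g.
have noX u v w : X u v -> v < w -> L u.+1 w.+1 -> X u w = false.
  move=> uv vw huw; apply/negP => uw; suff : v = w by lia.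
  by apply: (growth_col_uniq dL g _ _ uv uw) => //; apply: dL huw; lia.
have sizes u v w : X u v -> v < w -> L u.+1 w ->
    P u.+1 w + Q u.+1 w = P u w + Q u w + 1.
  move=> uv vw hw; rewrite (growth_size_col dL g hw).
  by have -> : has (X u) (iota 0 w) by apply/hasP; exists v; rewrite ?mem_iota.
have hi k : L i.+2 k -> L i.+1 k by apply: dL.
have hd u k : L u k.+1 -> L u k by apply: dL.
have xy : x != y.
  apply/eqP => e; rewrite e in ix xj.
  have hy : L i.+2 y.+1 by apply: dL h.
  by have := growth_row_uniq dL g (hi _ hy) hy ix iy; lia.
have [k ek] : exists k, j = (maxn x y).+1 + k by exists (j - (maxn x y).+1); lia.
rewrite {j}ek in h xj yj *; elim: k h {xj yj} => [|k IH] h.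
  rewrite addn0 in h *.
  have [[l0 _ l1 _] [s0 s1 r1]] := gcell i _ (hi _ h).
  have [[_ _ l2 _] [_ s2 r2]] := gcell i.+1 _ h.
  case: (ltngtP x y) xy => // lt _.
    have e : maxn x y = y by lia.
    rewrite e in h l0 l1 l2 s0 s1 r1 s2 r2 *.
    rewrite (noX i x y ix lt (hi _ h)) in r1; rewrite iy in r2.
    by apply/esym; apply: (cols_ascent_base_up l0 l1 s1 s0 _ _ r1 r2);
      apply: (sizes i x) => //; [exact/hd/hi|lia|exact: hi].
  have e : maxn x y = x by lia.
  rewrite e in h l0 l1 l2 s0 s1 r1 s2 r2 *.
  rewrite (noX i.+1 y x iy lt h) in r2; rewrite ix in r1.
  apply/esym/negbTE; apply: (cols_ascent_base_down l1 l2 s2 _ r1 r2).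
  by apply: (sizes i.+1 y) => //; exact: hd.
rewrite addnS in h *; have {}IH := IH (hd _ _ h); rewrite {}IH.
set j := (maxn x y).+1 + k in h *.
have xj : x < j by lia.
have yj : y < j by lia.
have [[l0 la l1 _] [s0 s1 r1]] := gcell i _ (hi _ h).
have [[_ _ l2 _] [t1 s2 r2]] := gcell i.+1 _ h.
rewrite (noX i x j ix xj (hi _ h)) in r1; rewrite (noX i.+1 y j iy yj h) in r2.
apply/esym/(cols_ascent_stable l0 l1 l2 la _ _ s1 s2 s0 t1 _ _ r1 r2).
- by apply: (sizes i x) => //; exact/hd/hi.
- by apply: (sizes i.+1 y) => //; exact/hd.
- by apply: (sizes i x); [|lia|exact: hi].
- by apply: (sizes i.+1 y); [|lia|].
Qed.

(** * Shifting runs *)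

Definition run_path (ins : nat -> bool) (P Q : nat -> nat) : Prop :=
  forall t, ins t -> [/\ Q t <= P t, Q t.+1 <= P t.+1 &
    (P t.+1 = (P t).+1 /\ Q t.+1 = Q t) \/ (P t.+1 = P t /\ Q t.+1 = (Q t).+1)].

(* Consecutive steps t with ins t form a run, along which d = P - Q is a lattice
   path with steps +1 and -1 staying nonnegative. Shifting moves the first step
   of each run to its end; if this would make the path negative, the step that
   first reaches -1 is reversed, and so is the moved step. The flag says whether
   the box removed from state t.+1 to get the new state t lies in Q. *)
Fixpoint shift_flag (ins : nat -> bool) (P Q : nat -> nat) (t : nat) : bool :=
  if t is t'.+1 then
    if ins t' then shift_flag ins P Q t' || (P t.+1 == Q t.+1) else Q t < Q t.+1
  else Q 0 < Q 1.

Definition shiftP ins P Q t := if ins t then P t.+1 - ~~ shift_flag ins P Q t else P t.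
Definition shiftQ ins P Q t := if ins t then Q t.+1 - shift_flag ins P Q t else Q t.

Lemma shift_flagS ins P Q t : shift_flag ins P Q t.+1 =
  if ins t then shift_flag ins P Q t || (P t.+2 == Q t.+2) else Q t.+1 < Q t.+2.
Proof. by []. Qed.

Section Shift.
Variables (ins : nat -> bool) (P Q : nat -> nat).
Hypothesis path : run_path ins P Q.

Let P' := shiftP ins P Q.
Let Q' := shiftQ ins P Q.
Let fl := shift_flag ins P Q.

(** The box to be removed exists and its removal leaves a partition, so the truncated subtractions
    in [shiftP] and [shiftQ] are exact. *)
Lemma shift_flag_box t : ins t -> if fl t then 0 < Q t.+1 else Q t.+1 < P t.+1.
Proof.
elim: t => [|t IH] it; have [l0 l1 s] := path it; rewrite /fl.
  by rewrite /=; case: ifP => h; lia.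
rewrite shift_flagS; case it': (ins t); last by case: ifP => h; lia.
by have := IH it'; rewrite /fl; case: (shift_flag ins P Q t) => /=; [|case: eqP]; lia.
Qed.

(** At the start of a run, the box removed from state [t.+1] is the one that step [t] added. *)
Lemma shift_start t : ins t -> (if t is t'.+1 then ~~ ins t' else true) ->
  P' t = P t /\ Q' t = Q t.
Proof.
move=> it st; rewrite /P' /Q' /shiftP /shiftQ it; have [_ _ s] := path it.
have -> : shift_flag ins P Q t = (Q t < Q t.+1).
  by case: t st {it s} => //= t /negbTE ->.
by case: ltnP => /=; lia.
Qed.

Lemma shift_size t : P' t + Q' t = P t + Q t.
Proof.
rewrite /P' /Q' /shiftP /shiftQ; case: ifP => // it.
have := shift_flag_box it; have [_ _ s] := path it.
by rewrite /fl; case: (shift_flag ins P Q t) => /=; lia.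
Qed.

Lemma shift_path : run_path ins P' Q'.
Proof.
move=> t it; have [l0 l1 s] := path it; have b := shift_flag_box it.
rewrite /P' /Q' /shiftP /shiftQ it.
case it': (ins t.+1); last first.
  by move: b; rewrite /fl; case: (shift_flag ins P Q t) => /= b; split; lia.
have [l2 l3 s'] := path it'; have b' := shift_flag_box it'; move: b b'.
rewrite /fl shift_flagS it; case: (shift_flag ins P Q t) => /= b; first by move=> b'; split; lia.
by case: eqP => e /= b'; split; lia.
Qed.

(** The new step [t] copies the old step [t.+1], except where the flag changes. There the old step
    is D, reaching [P = Q], and the new one is U; among the steps compared, the one before it is D
    and the one after it is U, so no UD is lost or created. *)
Lemma shift_peak t : ins t -> ins t.+1 -> ins t.+2 ->
  (P t.+1 < P t.+2) && (Q t.+2 < Q t.+3) =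
  (P' t < P' t.+1) && (Q' t.+1 < Q' t.+2).
Proof.
move=> i0 i1 i2; have [l0 l1 s0] := path i0; have [_ l2 s1] := path i1.
have [_ l3 s2] := path i2.
have := shift_flag_box i0; have := shift_flag_box i1; have := shift_flag_box i2.
rewrite /P' /Q' /shiftP /shiftQ i0 i1 i2 /fl !shift_flagS i0 i1.
case: (shift_flag ins P Q t) => /=; first by lia.
by case: eqP => e2; case: eqP => e3 /=; lia.
Qed.

End Shift.

(** A run is decoded from its end, where the state is unchanged. Given the old state [t.+2] and the
    flag at [t.+1], the shifted state [t] reveals the flag at [t]. *)
Lemma shift_inj n ins1 ins2 P1 Q1 P2 Q2 :
  run_path ins1 P1 Q1 -> run_path ins2 P2 Q2 -> ins1 =1 ins2 ->
  (forall t, ins1 t -> t < n) ->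
  (forall t, ins1 t ->
    [/\ shiftP ins1 P1 Q1 t = shiftP ins2 P2 Q2 t,
        shiftQ ins1 P1 Q1 t = shiftQ ins2 P2 Q2 t,
        shiftP ins1 P1 Q1 t.+1 = shiftP ins2 P2 Q2 t.+1 &
        shiftQ ins1 P1 Q1 t.+1 = shiftQ ins2 P2 Q2 t.+1]) ->
  forall t, ins1 t -> [/\ P1 t = P2 t, Q1 t = Q2 t, P1 t.+1 = P2 t.+1 & Q1 t.+1 = Q2 t.+1].
Proof.
move=> p1 p2 ei bi es.
have main t : ins1 t -> [/\ shift_flag ins1 P1 Q1 t = shift_flag ins2 P2 Q2 t,
    P1 t.+1 = P2 t.+1 & Q1 t.+1 = Q2 t.+1].
  have [k] := ubnP (n - t); elim: k t => // k IH t hk it.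
  have it2 : ins2 t by rewrite -ei.
  have [] := es t it; rewrite /shiftP /shiftQ it it2 -ei.
  have b1 := shift_flag_box p1 it; have b2 := shift_flag_box p2 it2.
  case it' : (ins1 t.+1); last first.
    move: b1 b2; case: (shift_flag ins1 P1 Q1 t); case: (shift_flag ins2 P2 Q2 t) => /=;
      by split=> //; lia.
  have it2' : ins2 t.+1 by rewrite -ei.
  have [|ef eP eQ] := IH t.+1 _ it'; first by have := bi _ it'; lia.
  move: ef; rewrite !shift_flagS it it2.
  have [l0 l1 s1] := p1 _ it'; have [m0 m1 s2] := p2 _ it2'.
  move: b1 b2 s1 s2 l0 l1 m0 m1; rewrite eP eQ; clear.
  case: (shift_flag ins1 P1 Q1 t); case: (shift_flag ins2 P2 Q2 t) => /= b1 b2;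
    case=> [[? ?]|[? ?]]; case=> [[? ?]|[? ?]]; do ?[case: eqP => /= ?];
    by split; lia.
have prev t : ins1 t -> P1 t = P2 t /\ Q1 t = Q2 t.
  move=> it; case: t it => [|t] it.
    have [e1 e2 _ _] := es _ it; have it2 : ins2 0 by rewrite -ei.
    have [<- <-] := shift_start p1 it isT; have [<- <-] := shift_start p2 it2 isT.
    by [].
  case it' : (ins1 t); first by have [_ -> ->] := main _ it'.
  have [e1 e2 _ _] := es _ it; have it2 : ins2 t.+1 by rewrite -ei.
  have st : ~~ ins1 t by rewrite it'.
  have st2 : ~~ ins2 t by rewrite -ei it'.
  have [<- <-] := shift_start p1 it st; have [<- <-] := shift_start p2 it2 st2.
  by [].
by move=> t it; have [-> ->] := prev _ it; have [_ -> ->] := main _ it.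
Qed.

(* Column t belongs to the board up to height j exactly and has a point there. *)
Definition in_run (L : nat -> nat -> bool) (P Q : nat -> nat -> nat) (j t : nat) :=
  [&& L t.+1 j, ~~ L t.+1 j.+1 & P t j + Q t j < P t.+1 j + Q t.+1 j].

(* The shift acts on the horizontal runs of the border, and by transposition on
   the vertical ones. *)
Definition border_shift (sh : (nat -> bool) -> (nat -> nat) -> (nat -> nat) -> nat -> nat)
    (F : nat -> nat -> nat) (L : nat -> nat -> bool) (P Q : nat -> nat -> nat) (i j : nat) :=
  if in_run L P Q j i then sh (in_run L P Q j) (P^~ j) (Q^~ j) i
  else if in_run L P Q i j then sh (in_run L P Q i) (P^~ i) (Q^~ i) j
  else F i j.

Definition bshiftP L P Q := border_shift shiftP P L P Q.
Definition bshiftQ L P Q := border_shift shiftQ Q L P Q.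

Definition sym_on (L : nat -> nat -> bool) (P : nat -> nat -> nat) :=
  forall i j, L i j -> P i j = P j i.

Section BorderShift.
Variables (n : nat) (L : nat -> nat -> bool).
Hypotheses (dL : down_closed L) (bL : bounded_by n L).
Hypothesis sL : forall i j, L i j = L j i.
Variables (r : bool) (X : nat -> nat -> bool) (P Q : nat -> nat -> nat).
Hypotheses (g : growth r L X P Q) (sP : sym_on L P) (sQ : sym_on L Q).

Lemma in_run_path j : run_path (in_run L P Q j) (P^~ j) (Q^~ j).
Proof.
move=> t /and3P[h1 h2 lt]; have h0 : L t j by apply: dL h1.
have := growth_step_right dL g h1; rewrite /box_step.
by split; [exact: (growth_le g)|exact: (growth_le g)|lia].
Qed.

(** At the left end of a horizontal border edge, a vertical run can only start, and by [shift_start]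
    it keeps the state there. Hence the two kinds of shift do not interfere. *)
Lemma in_run_cross i j : L i.+1 j -> (if j is j'.+1 then ~~ in_run L P Q i j' else true).
Proof. by case: j => // j h; rewrite /in_run [L _ i.+1]sL h /= andbF. Qed.

Lemma bshift_row i j : L i.+1 j -> ~~ L i.+1 j.+1 ->
  [/\ bshiftP L P Q i j = shiftP (in_run L P Q j) (P^~ j) (Q^~ j) i,
      bshiftQ L P Q i j = shiftQ (in_run L P Q j) (P^~ j) (Q^~ j) i,
      bshiftP L P Q i.+1 j = shiftP (in_run L P Q j) (P^~ j) (Q^~ j) i.+1 &
      bshiftQ L P Q i.+1 j = shiftQ (in_run L P Q j) (P^~ j) (Q^~ j) i.+1].
Proof.
move=> h h1; rewrite /bshiftP /bshiftQ /border_shift.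
have h0 : L i j by apply: dL h.
have -> : in_run L P Q i.+1 j = false by rewrite /in_run sL (negbTE h1).
have [s1 s2] :
    (if in_run L P Q i j then shiftP (in_run L P Q i) (P^~ i) (Q^~ i) j
     else P i j) = P i j /\
    (if in_run L P Q i j then shiftQ (in_run L P Q i) (P^~ i) (Q^~ i) j
     else Q i j) = Q i j.
  case: ifP => // rn; have [-> ->] := shift_start (@in_run_path i) rn (in_run_cross h).
  by rewrite (sP h0) (sQ h0).
rewrite s1 s2 /shiftP /shiftQ.
by split=> //=; case: (in_run L P Q j _).
Qed.

Lemma bshift_sym : sym_on L (bshiftP L P Q) /\ sym_on L (bshiftQ L P Q).
Proof.
suff S i j : L i j -> bshiftP L P Q i j = bshiftP L P Q j i /\
    bshiftQ L P Q i j = bshiftQ L P Q j i.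
  by split=> i j /S[].
move=> h; rewrite /bshiftP /bshiftQ /border_shift.
case a: (in_run L P Q j i); case b: (in_run L P Q i j) => //; last first.
  by rewrite (sP h) (sQ h).
have [h1 _] := andP a; have [h2 _] := andP b.
have [-> ->] := shift_start (@in_run_path j) a (in_run_cross h2).
have [-> ->] := shift_start (@in_run_path i) b (in_run_cross h1).
by rewrite (sP h) (sQ h).
Qed.

Lemma bshift_size i j : L i j ->
  bshiftP L P Q i j + bshiftQ L P Q i j = P i j + Q i j.
Proof.
move=> h; rewrite /bshiftP /bshiftQ /border_shift.
case: ifP => _; first by rewrite (shift_size (@in_run_path j)).
case: ifP => _; first by rewrite (shift_size (@in_run_path i)) (sP h) (sQ h).
by [].
Qed.

Lemma growth_border_path : border_path L P Q.
Proof.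
split=> [i j /andP[h _]|i j /andP[h h1] hr|i j /andP[h h1] hr|i j /andP[h h1]].
- exact: (growth_le g).
- exact: (growth_step_right dL g).
- exact: (growth_step_up dL g).
- case: g => a0 a1 _; case: i j h {h1} => [|i] [|j] h //; rewrite ?muln0 => _.
  + by have [-> ->] := a0 _ h.
  + by have [-> ->] := a1 _ h.
  + by have [-> ->] := a0 _ h.
Qed.

Lemma bshift_border_path : border_path L (bshiftP L P Q) (bshiftQ L P Q).
Proof.
have [s1 s2] := bshift_sym.
have right i j : border L i j -> L i.+1 j ->
    box_step (bshiftP L P Q i j) (bshiftQ L P Q i j)
             (bshiftP L P Q i.+1 j) (bshiftQ L P Q i.+1 j).
  move=> /andP[h h1] hr; have [-> -> -> ->] := bshift_row hr h1.
  case rn: (in_run L P Q j i).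
    by have [_ _ s] := shift_path (@in_run_path j) rn; rewrite /box_step; lia.
  have -> : shiftP (in_run L P Q j) (P^~ j) (Q^~ j) i = P i j by rewrite /shiftP rn.
  have -> : shiftQ (in_run L P Q j) (P^~ j) (Q^~ j) i = Q i j by rewrite /shiftQ rn.
  case rn': (in_run L P Q j i.+1); last first.
    by rewrite /shiftP /shiftQ rn'; exact: (growth_step_right dL g).
  have [|-> ->] := shift_start (@in_run_path j) rn'; first by rewrite rn.
  exact: (growth_step_right dL g).
split=> // [i j /andP[h h1]|i j bij hu|i j bij z].
- rewrite /bshiftP /bshiftQ /border_shift.
  case: ifP => rn; first by have [] := shift_path (@in_run_path j) rn.
  case: ifP => rn'; first by have [] := shift_path (@in_run_path i) rn'.
  exact: (growth_le g).
- have h : L i j by case/andP: bij.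
  rewrite (s1 _ _ h) (s2 _ _ h) (s1 _ _ hu) (s2 _ _ hu).
  by apply: right; rewrite /border sL // [L j.+1 i.+1]sL.
- have h : L i j by case/andP: bij.
  by rewrite bshift_size //; have [_ _ _ h0] := growth_border_path; exact: h0.
Qed.

End BorderShift.

(** Shifting preserves sizes, so both borders have the same runs, and [shift_inj] applies to
    each. *)
Lemma bshift_inj n L r X1 P1 Q1 X2 P2 Q2 :
  down_closed L -> bounded_by n L -> (forall i j, L i j = L j i) ->
  growth r L X1 P1 Q1 -> sym_on L P1 -> sym_on L Q1 ->
  growth r L X2 P2 Q2 -> sym_on L P2 -> sym_on L Q2 ->
  (forall i j, border L i j -> bshiftP L P1 Q1 i j = bshiftP L P2 Q2 i j /\
                               bshiftQ L P1 Q1 i j = bshiftQ L P2 Q2 i j) ->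
  forall i j, border L i j -> P1 i j = P2 i j /\ Q1 i j = Q2 i j.
Proof.
move=> dL bL sL g1 sP1 sQ1 g2 sP2 sQ2 eb.
have size_eq i j : border L i j -> P1 i j + Q1 i j = P2 i j + Q2 i j.
  move=> bij; have h : L i j by case/andP: bij.
  rewrite -(bshift_size dL g1 sP1 sQ1 h) -(bshift_size dL g2 sP2 sQ2 h).
  by have [-> ->] := eb _ _ bij.
have ei j : in_run L P1 Q1 j =1 in_run L P2 Q2 j.
  move=> t; rewrite /in_run.
  have [h|//] := boolP (L t.+1 j); have [//|h1] := boolP (L t.+1 j.+1).
  have b0 : border L t j by rewrite /border h1 (dL _ _ _ _ _ _ h).
  have b1 : border L t.+1 j by rewrite /border h; apply: contra h1; apply: dL.
  by rewrite (size_eq _ _ b0) (size_eq _ _ b1).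
have row i j : in_run L P1 Q1 j i -> P1 i j = P2 i j /\ Q1 i j = Q2 i j.
  move=> rn.
  have [||//] := @shift_inj n _ _ _ _ _ _ (in_run_path dL g1 (j := j))
    (in_run_path dL g2 (j := j)) (ei j) _ _ i rn.
  - by move=> t /and3P[/bL]; lia.
  - move=> t /and3P[h h1 _].
    have b0 : border L t j by rewrite /border h1 (dL _ _ _ _ _ _ h).
    have b1 : border L t.+1 j by rewrite /border h; apply: contra h1; apply: dL.
    have [<- <- <- <-] := bshift_row dL sL g1 sP1 sQ1 h h1.
    have [<- <- <- <-] := bshift_row dL sL g2 sP2 sQ2 h h1.
    by have [-> ->] := eb _ _ b0; have [-> ->] := eb _ _ b1.
move=> i j bij; have h : L i j by case/andP: bij.
have := eb _ _ bij; rewrite /bshiftP /bshiftQ /border_shift -!ei.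
case: ifP => [/row //|_]; case: ifP => // /row [e1 e2] _.
by rewrite (sP1 _ _ h) (sQ1 _ _ h) (sP2 _ _ h) (sQ2 _ _ h).
Qed.

(** At the height [J] of column [i], the size grows along the border edge exactly when the column
    has a point on the board. *)
Lemma border_size_cols n r r' L X X' P Q P' Q' :
  down_closed L -> bounded_by n L -> growth r L X P Q -> growth r' L X' P' Q' ->
  (forall i j, border L i j -> P i j + Q i j = P' i j + Q' i j) ->
  forall i j, X i j -> L i.+1 j.+1 -> exists j', X' i j' /\ L i.+1 j'.+1.
Proof.
move=> dL bL g g' es i j ij h.
have [J LJ mJ] := ex_maxnP (ex_intro (fun J => L i.+1 J) _ h) (fun J hJ => (bL _ _ hJ).2).
have h1 : ~~ L i.+1 J.+1 by apply/negP => /mJ; lia.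
have jJ := mJ _ h.
have b0 : border L i J by rewrite /border h1 (dL _ _ _ _ _ _ LJ).
have b1 : border L i.+1 J by rewrite /border LJ; apply: contra h1; apply: dL.
have := growth_size_col dL g LJ; have := growth_size_col dL g' LJ.
rewrite (es _ _ b0) (es _ _ b1).
have -> : has (X i) (iota 0 J) by apply/hasP; exists j; rewrite ?mem_iota.
case: hasP => [[j']|_]; last by lia.
by rewrite mem_iota => j'J ij' _ _; exists j'; split=> //; apply: dL LJ.
Qed.

(** * Boards of involutions *)

Definition graph (n : nat) (p : 'S_n) (i j : nat) : bool :=
  [exists k : 'I_n, (k == i :> nat) && (p k == j :> nat)].

Lemma graphP n (p : 'S_n) i j :
  reflect (exists2 k : 'I_n, k = i :> nat & p k = j :> nat) (graph p i j).
Proof.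
apply: (iffP existsP) => [[k /andP[/eqP ki /eqP kj]]|[k ki kj]]; exists k => //.
by rewrite ki kj !eqxx.
Qed.

Lemma graph_ord n (p : 'S_n) (k : 'I_n) j : graph p k j = (p k == j :> nat).
Proof.
apply/graphP/eqP => [[l /val_inj -> //]|e]; by exists k.
Qed.

Lemma graph_matching n (p : 'S_n) : partial_matching (graph p).
Proof.
split=> [i j j' /graphP[k <- <-]|i i' j /graphP[k <- <-]].
  by rewrite graph_ord => /eqP.
by case/graphP=> l <- /val_inj /perm_inj ->.
Qed.

Lemma involutionP n (p : 'S_n) : reflect (forall k, p (p k) = k) (involution p).
Proof.
apply: (iffP eqP) => [e k|e]; first by rewrite {1}e permK.
by apply/permP => k; apply: (@perm_inj _ p); rewrite e permKV.
Qed.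

Lemma graph_sym n (p : 'S_n) i j : involution p -> graph p i j = graph p j i.
Proof.
move/involutionP => pp.
by apply/graphP/graphP => [] [k <- <-]; exists (p k); rewrite ?pp.
Qed.

Definition is_occ n k (p : 'S_n) (s : 'S_k) (f : 'I_k -> 'I_n) : Prop :=
  (forall i j : 'I_k, i < j -> f i < f j) /\
  (forall i j : 'I_k, (p (f i) < p (f j)) = (s i < s j)).

Lemma containsP n k (p : 'S_n) (s : 'S_k) :
  reflect (exists f, is_occ p s f) (contains p s).
Proof.
apply: (iffP existsP) => [[f /andP[/forallP h1 /forallP h2]]|[f [h1 h2]]].
  exists f; split=> i j; first by move/forallP: (h1 i) => /(_ j)/implyP.
  by move/forallP: (h2 i) => /(_ j)/eqP.
exists (finfun f); apply/andP; split; apply/forallP=> i; apply/forallP=> j;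
  rewrite !ffunE; first by apply/implyP/h1.
by rewrite h2.
Qed.

Definition occurs_from n m (p : 'S_n) (t : 'S_m) (i j : nat) : bool :=
  [exists f : {ffun 'I_m -> 'I_n},
     [forall a : 'I_m, forall b : 'I_m, (a < b) ==> (f a < f b)] &&
     [forall a : 'I_m, forall b : 'I_m, (p (f a) < p (f b)) == (t a < t b)] &&
     [forall a : 'I_m, (i <= f a) && (j <= p (f a))]].

Lemma occurs_fromP n m (p : 'S_n) (t : 'S_m) i j :
  reflect (exists2 f, is_occ p t f & forall a, i <= f a /\ j <= p (f a))
          (occurs_from p t i j).
Proof.
apply: (iffP existsP) => [[f /andP[/andP[/forallP h1 /forallP h2] /forallP h3]]|[f [h1 h2] h3]].
  exists f; last by move=> a; apply/andP.
  split=> a b; first by move/forallP: (h1 a) => /(_ b)/implyP.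
  by move/forallP: (h2 a) => /(_ b)/eqP.
exists (finfun f); apply/andP; split; [apply/andP; split|];
  apply/forallP=> a; try (apply/forallP=> b); rewrite !ffunE.
- by apply/implyP/h1.
- by rewrite h2.
- exact/andP/h3.
Qed.

Lemma contains_dsumP n k m (p : 'S_n) (s : 'S_k) (t : 'S_m) :
  contains p (dsum s t) <->
  exists e f, [/\ is_occ p s e, is_occ p t f &
    forall a b, e a < f b /\ p (e a) < p (f b)].
Proof.
have dl a : dsum s t (lshift m a) = lshift m (s a).
  by rewrite permE /dsum_fun -[lshift m a]/(unsplit (inl a)) unsplitK.
have dr a : dsum s t (rshift k a) = rshift k (t a).
  by rewrite permE /dsum_fun -[rshift k a]/(unsplit (inr a)) unsplitK.
split=> [/containsP[h [h1 h2]]|[e [f [[e1 e2] [f1 f2] ef]]]].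
  exists (fun a => h (lshift m a)), (fun b => h (rshift k b)); split.
  - by split=> a b; [move=> ab; exact: h1|rewrite h2 !dl].
  - by split=> a b; [move=> ab; apply: h1; rewrite /= ltn_add2l|rewrite h2 !dr /= ltn_add2l].
  - move=> a b; split.
      by apply: h1; rewrite /=; have := ltn_ord a; lia.
    by rewrite h2 dl dr /=; have := ltn_ord (s a); lia.
apply/containsP; exists (fun i => match split i with inl a => e a | inr b => f b end).
have sl a : split (lshift m a) = inl a by rewrite -[lshift m a]/(unsplit (inl a)) unsplitK.
have sr b : split (rshift k b) = inr b by rewrite -[rshift k b]/(unsplit (inr b)) unsplitK.
split=> i j; case: (split_ordP i) => a ->; case: (split_ordP j) => b ->;
  rewrite ?sl ?sr ?dl ?dr /=.
- exact: e1.
- by have [] := ef a b.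
- by have := ltn_ord b; lia.
- by rewrite ltn_add2l; exact: f1.
- exact: e2.
- by have [_ ->] := ef a b; have := ltn_ord (s a); lia.
- by have [_] := ef b a; have := ltn_ord (s b); lia.
- by rewrite ltn_add2l; exact: f2.
Qed.

Definition pat (r : bool) : 'S_3 := if r then pat321 else pat123.

Lemma contains_patP r n m (p : 'S_n) (t : 'S_m) :
  contains p (dsum (pat r) t) <->
  exists x u i : 'I_n, [/\ x < u < i,
    if r then p i < p u < p x else p x < p u < p i &
    occurs_from p t i.+1 (if r then p x else p i).+1].
Proof.
split=> [/contains_dsumP[e [f [[e1 e2] fo ef]]]|[x [u [i [xui pxui /occurs_fromP[f fo ef]]]]]].
  pose a0 : 'I_3 := @Ordinal 3 0 isT; pose a1 : 'I_3 := @Ordinal 3 1 isT.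
  pose a2 : 'I_3 := @Ordinal 3 2 isT.
  exists (e a0), (e a1), (e a2); split; first by rewrite !e1.
    by rewrite !e2 /pat; case: (r); rewrite ?permE.
  by apply/occurs_fromP; exists f => // b; case: (r); split; case: (ef a0 b); case: (ef a2 b).
apply/contains_dsumP; exists (fun a : 'I_3 => nth x [:: x; u; i] a), f; split=> //.
- move: xui pxui => /andP[xu ui]; rewrite /pat.
  split=> [[[|[|[|a]]] ha] [[|[|[|b]]] hb]|[[|[|[|a]]] ha] [[|[|[|b]]] hb]] //=; try lia;
    by move: pxui; case: (r); rewrite ?permE /=; lia.
- move=> [[|[|[|a]]] ha] b //=; have := ef b; move: pxui; case: (r); lia.
Qed.

(* Closing under transposition makes the board of an involution symmetric; it
   amounts to treating t and its inverse together. *)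
Definition board n m (p : 'S_n) (t : 'S_m) (i j : nat) : bool :=
  [&& i <= n, j <= n & occurs_from p t i j || occurs_from p t j i].

Section Board.
Variables (n m : nat) (p : 'S_n) (t : 'S_m).

Lemma occurs_from_down i j i' j' : i' <= i -> j' <= j ->
  occurs_from p t i j -> occurs_from p t i' j'.
Proof.
move=> hi hj /occurs_fromP[f fo ef]; apply/occurs_fromP; exists f => // a.
by have := ef a; lia.
Qed.

Lemma board_down : down_closed (board p t).
Proof.
move=> i j i' j' hi hj /and3P[h1 h2 h]; apply/and3P; split; try lia.
by case/orP: h => h; apply/orP; [left|right]; apply: occurs_from_down h.
Qed.

Lemma board_bounded : bounded_by n (board p t).
Proof. by move=> i j /and3P[]. Qed.

Lemma board_sym i j : board p t i j = board p t j i.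
Proof. by rewrite /board orbC; case: (i <= n); case: (j <= n). Qed.

(** If a corner is on the board by a transposed copy of [t], the three points are transposed too:
    [p], 123 and 321 are their own inverses. *)
Lemma avoids_patP r : involution p ->
  (~~ contains p (dsum (pat r) t)) <-> avoids_on r (board p t) (graph p).
Proof.
move=> /involutionP pp; split=> [/negP nc x u i y v j xui yvj|av].
  move=> h /graphP[ku kx kv]; apply/negP => /and3P[hi hj /orP[] oc]; apply: nc; apply/contains_patP.
    case: r h => /andP[/graphP[k1 k2 k3] /graphP[k4 k5 k6]].
      by exists k1, ku, k4; rewrite k2 k3 k5 k6 kx kv; split.
    by exists k1, ku, k4; rewrite k2 k3 k5 k6 kx kv; split.
  case: r h => /andP[/graphP[k1 k2 k3] /graphP[k4 k5 k6]].
    by exists (p k4), (p ku), (p k1); rewrite !pp k2 k3 k5 k6 kx kv; split.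
  by exists (p k1), (p ku), (p k4); rewrite !pp k2 k3 k5 k6 kx kv; split.
apply/negP => /contains_patP[x [u [i [xui pxui oc]]]].
case: r pxui oc av => pxui oc av.
  have := av x u i (p i) (p u) (p x) xui pxui; rewrite !graph_ord !eqxx => /(_ isT isT).
  by rewrite /board oc !ltn_ord.
have := av x u i (p x) (p u) (p i) xui pxui; rewrite !graph_ord !eqxx => /(_ isT isT).
by rewrite /board oc !ltn_ord.
Qed.

End Board.

(* A copy of t beyond a maximal point of the board lies outside of the board. *)
Lemma board_stable n m (p p' : 'S_n) (t : 'S_m) :
  (forall i : 'I_n, ~~ board p t i.+1 (p i).+1 -> p' i = p i) ->
  forall i j, board p t i j -> board p' t i j.
Proof.
move=> ag i j; have [k] := ubnP (n + n - (i + j)); elim: k i j => // k IH i j hk h.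
have [h1|h1] := boolP (board p t i.+1 j).
  have [ni nj] := board_bounded h1.
  by apply: (board_down (leqnSn i) (leqnn j)); apply: IH => //; lia.
have [h2|h2] := boolP (board p t i j.+1).
  have [ni nj] := board_bounded h2.
  by apply: (board_down (leqnn i) (leqnSn j)); apply: IH => //; lia.
have main a b : board p t a b -> ~~ board p t a.+1 b -> occurs_from p t a b -> occurs_from p' t a b.
  move=> hab hab' /occurs_fromP[f [f1 f2] ef]; apply/occurs_fromP.
  have e c : p' (f c) = p (f c).
    apply: ag; apply: contra hab'; have := ef c => -[ea eb].
    by apply: board_down; lia.
  by exists f => [|c]; [split=> // c d; rewrite !e|rewrite e].
case/and3P: (h) => hi hj /orP[] oc; apply/and3P; split=> //; apply/orP; [left|right].
  exact: main.
by apply: main => //; rewrite board_sym.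
Qed.

(** Equal border sizes make the new filling occupy the same rows and columns of the board as [p], so
    the rest of [p] can be kept. Symmetric border data force a symmetric filling by backward
    uniqueness. *)
Lemma involution_of_border_path n L r r' (p : 'S_n) P Q GP GQ :
  down_closed L -> bounded_by n L -> (forall i j, L i j = L j i) ->
  involution p -> growth r L (graph p) P Q ->
  border_path L GP GQ -> sym_on L GP -> sym_on L GQ ->
  (forall i j, border L i j -> GP i j + GQ i j = P i j + Q i j) ->
  exists p' : 'S_n, [/\ involution p',
    forall i : 'I_n, ~~ L i.+1 (p i).+1 -> p' i = p i,
    forall i : 'I_n, ~~ L i.+1 (p' i).+1 -> p' i = p i &
    exists P' Q', growth r' L (graph p') P' Q' /\
      forall i j, border L i j -> P' i j = GP i j /\ Q' i j = GQ i j].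
Proof.
move=> dL bL sL ip g bp sP sQ es.
have [X [P' [Q' [g' XL eb]]]] := border_path_growth r' dL bL bp.
have pp := involutionP _ ip.
have es1 i j : border L i j -> P i j + Q i j = P' i j + Q' i j.
  by move=> b; have [-> ->] := eb _ _ b; rewrite es.
have es2 i j : border L i j -> P' i j + Q' i j = P i j + Q i j by move/es1.
have symb i j : border L i j -> border L j i.
  by rewrite /border sL [L j.+1 i.+1]sL.
have es3 i j : border (flip L) i j -> flip P i j + flip Q i j = flip P' i j + flip Q' i j.
  by move=> b; apply: es1; exact: b.
have colX (i j : 'I_n) : graph p i j -> L i.+1 j.+1 -> exists j', X i j'.
  move=> gij h; have [j' [xj _]] := border_size_cols dL bL g g' es1 gij h.
  by exists j'.
have colp (i : 'I_n) j : X i j -> L i.+1 (p i).+1.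
  move=> xij; have [j' []] := border_size_cols dL bL g' g es2 xij (XL _ _ xij).
  by rewrite graph_ord => /eqP ->.
have rowp i (j : 'I_n) : X i j -> L (p j).+1 j.+1.
  move=> xij.
  have bLf : bounded_by n (flip L) by move=> a b /bL [].
  have es4 a b : border (flip L) a b -> flip P' a b + flip Q' a b = flip P a b + flip Q a b.
    by move/es3.
  have [k [gk hk]] := border_size_cols (down_closed_flip dL) bLf (growth_flip g')
    (growth_flip g) es4 (xij : flip X j i) (XL _ _ xij).
  move: gk; rewrite /flip -(graph_sym _ _ ip) graph_ord => /eqP ->; exact: hk.
pose f (i : 'I_n) : 'I_n := if [pick j : 'I_n | X i j] is Some j then j else p i.
have fX (i : 'I_n) (j : nat) : X i j -> f i = j :> nat.
  move=> xij; have [_ jn] := bL _ _ (XL _ _ xij); rewrite /f.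
  case: pickP => [j' xij'|/(_ (Ordinal jn))]; last by rewrite /= xij.
  exact: (growth_col_uniq dL g' (XL _ _ xij') (XL _ _ xij) xij' xij).
have fNX (i : 'I_n) : (forall j, ~~ X i j) -> f i = p i.
  by move=> nx; rewrite /f; case: pickP => // j; rewrite (negbTE (nx j)).
have fP (i : 'I_n) : X i (f i) \/ (forall j, ~~ X i j) /\ f i = p i.
  rewrite /f; case: pickP => [j xij|nx]; [by left|right; split=> // j].
  by apply/negP => xij; have [_ jn] := bL _ _ (XL _ _ xij); have := nx (Ordinal jn); rewrite /= xij.
have f_inj : injective f.
  (* If a new point shared its row with a kept value, [rowp] would put the kept value on the board,
     and its column would have a new point. *)
  have mixed (i i' : 'I_n) : X i (f i) -> (forall j, ~~ X i' j) -> f i' = p i' -> f i <> f i'.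
    move=> xi nx' ei' e; have := rowp _ _ xi; rewrite e ei' pp => h.
    have [|j' xj'] := colX i' (p i') _ h; first by rewrite graph_ord.
    by have := nx' j'; rewrite xj'.
  move=> i i' e; have [xi|[nx ei]] := fP i; have [xi'|[nx' ei']] := fP i'.
  - apply/val_inj; move: xi'; rewrite -e => xi'.
    exact: (growth_row_uniq dL g' (XL _ _ xi) (XL _ _ xi') xi xi').
  - by case: (mixed _ _ xi nx' ei').
  - by case: (mixed _ _ xi' nx ei).
  - by apply: (@perm_inj _ p); rewrite -ei -ei'.
pose p' : 'S_n := perm f_inj.
have pf i : p' i = f i by rewrite permE.
have gX i j : L i.+1 j.+1 -> X i j = graph p' i j.
  move=> h; have [hi hj] := bL _ _ h.
  apply/idP/graphP => [xij|[k ki kj]].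
    by exists (Ordinal hi) => //; rewrite pf; exact: fX.
  rewrite -ki -kj pf in h *; have [//|[nx e]] := fP k.
  have gk : graph p k (p k) by rewrite graph_ord.
  rewrite e in h *; have [j' xj'] := colX _ _ gk h.
  by have := nx j'; rewrite xj'.
have gp' : growth r' L (graph p') P' Q'.
  by case: g' => a0 a1 ac; split=> // i j h; rewrite -gX //; exact: ac.
have ag1 (i : 'I_n) : ~~ L i.+1 (p i).+1 -> p' i = p i.
  move=> h; rewrite pf; apply: fNX => j; apply: contra h; exact: colp.
have ag2 (i : 'I_n) : ~~ L i.+1 (p' i).+1 -> p' i = p i.
  rewrite pf; have [/XL -> //|[_ ->] //] := fP i.
exists p'; split=> //; last by exists P', Q'.
have [_ symX] : (forall i j, L i j -> P' i j = flip P' i j /\ Q' i j = flip Q' i j) /\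
    (forall i j, L i.+1 j.+1 -> graph p' i j = flip (graph p') i j).
  have gf : growth r' L (flip (graph p')) (flip P') (flip Q').
    by apply: growth_sub (growth_flip gp') => i j; rewrite /flip sL.
  apply: (growth_backward_uniq dL bL gp' gf) => i j b; rewrite /flip.
  have [-> ->] := eb _ _ b; have [-> ->] := eb _ _ (symb _ _ b).
  by have /andP[h _] := b; rewrite (sP _ _ h) (sQ _ _ h).
apply/involutionP => k; have [h|h] := boolP (L k.+1 (p' k).+1).
  have := symX _ _ h; rewrite /flip !graph_ord eqxx => /esym/eqP e.
  exact/val_inj.
have e := ag2 _ h; rewrite e in h *.
by rewrite ag1 pp // sL.
Qed.

(** * Preservation of peaks *)

Definition inside n m (p : 'S_n) (t : 'S_m) (i : 'I_n) : bool :=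
  board p t i.+1 (p i).+1.

Section Columns.
Variables (n m : nat) (p : 'S_n) (t : 'S_m).
Let L := board p t.

Lemma descent_into (a b : 'I_n) : b = a.+1 :> nat ->
  ~~ inside p t a -> inside p t b -> p b < p a.
Proof.
move=> ab na ib; rewrite ltnNge; apply: contra na => le.
by apply: board_down ib; lia.
Qed.

Lemma board_height i j : L i j -> exists h, [/\ j <= h, L i h & ~~ L i h.+1].
Proof.
move=> hL.
have [h Lh mh] := ex_maxnP (ex_intro (fun h => L i h) _ hL) (fun h hh => (board_bounded hh).2).
exists h; split=> //; first exact: mh.
by apply/negP => /mh; lia.
Qed.

Hypothesis ip : involution p.

(* Every copy of t beyond the corner (i.+1, h) uses column k, for otherwise
   (i.+2, h) would be on the board. *)
Lemma board_corner_above (k : 'I_n) i h : k = i.+1 :> nat ->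
  L i.+1 h -> ~~ L i.+2 h -> h <= p k.
Proof.
move/involutionP: ip => pp ek /and3P[hi hh oc] nL.
have kn := ltn_ord k.
have hi2 : i.+2 <= n by lia.
case/orP: oc => /occurs_fromP[f fo ef].
  have [/existsP[a /eqP ea]|/existsPn ne] := boolP [exists a, f a == k].
    by rewrite -ea; case: (ef a).
  case/and3P: nL; split=> //; apply/orP; left; apply/occurs_fromP; exists f => // a.
  by have := ef a; have := ne a; rewrite -val_eqE /=; lia.
have [/existsP[a /eqP ea]|/existsPn ne] := boolP [exists a, p (f a) == k].
  by rewrite -ea pp; case: (ef a).
case/and3P: nL; split=> //; apply/orP; right; apply/occurs_fromP; exists f => // a.
by have := ef a; have := ne a; rewrite -val_eqE /=; lia.
Qed.

(** If column [b] still reaches height [h], its point is outside only by lying above; if not,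
    [board_corner_above] applies. *)
Lemma ascent_out_of (a b : 'I_n) : b = a.+1 :> nat ->
  inside p t a -> ~~ inside p t b -> p a < p b.
Proof.
move=> ab ia nb; have [h [ah Lh nLh]] := board_height ia.
suff : h <= p b by lia.
have [Lb|nLb] := boolP (L b.+1 h); last first.
  by apply: (board_corner_above ab) => //; rewrite -ab.
rewrite leqNgt; apply: contra nb => lt.
by apply: board_down Lb.
Qed.

Lemma inside_same_height (a b : 'I_n) h : b = a.+1 :> nat ->
  inside p t a -> inside p t b -> L a.+1 h -> ~~ L a.+1 h.+1 -> L b.+1 h /\ ~~ L b.+1 h.+1.
Proof.
move=> ab ia ib Lh nLh; split; last by apply: contra nLh; apply: board_down; lia.
have [//|nLb] := boolP (L b.+1 h).
have hb : h <= p b by apply: (board_corner_above ab) => //; rewrite -ab.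
by case/negP: nLb; apply: board_down ib; lia.
Qed.

End Columns.

(** * Symmetric diagrams and the two injections *)

Lemma growth_ext r L X X' P Q : (forall i j, X i j = X' i j) ->
  growth r L X P Q -> growth r L X' P Q.
Proof. by move=> e [a0 a1 ac]; split=> // i j h; rewrite -e; exact: ac. Qed.

Lemma growth_sym n r L (p : 'S_n) P Q : down_closed L -> (forall i j, L i j = L j i) ->
  involution p -> growth r L (graph p) P Q -> sym_on L P /\ sym_on L Q.
Proof.
move=> dL sL ip g.
have gf : growth r L (graph p) (flip P) (flip Q).
  apply: growth_ext (growth_sub _ (growth_flip g)) => i j; last by rewrite /flip sL.
  by rewrite /flip graph_sym.
by split=> i j h; have [] := growth_forward_uniq dL g gf h.
Qed.

(** Serves both maps: with [sh] the peak-preserving one from 321 to 123, without it the map back,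
    which only rereads the border data. *)
Definition related (sh r r' : bool) n m (t : 'S_m) (p p' : 'S_n) : Prop :=
  let L := board p t in
  [/\ L = board p' t,
      forall i : 'I_n, ~~ L i.+1 (p i).+1 -> p' i = p i,
      forall i : 'I_n, ~~ L i.+1 (p' i).+1 -> p' i = p i &
      exists P Q P' Q',
      [/\ growth r L (graph p) P Q, growth r' L (graph p') P' Q' &
          forall i j, border L i j ->
            P' i j = (if sh then bshiftP L P Q i j else P i j) /\
            Q' i j = (if sh then bshiftQ L P Q i j else Q i j)]].

Lemma in_avoiding r n m (t : 'S_m) (p : 'S_n) :
  p \in avoiding_involutions n (dsum (pat r) t) <->
  involution p /\ avoids_on r (board p t) (graph p).
Proof.
rewrite inE; split=> [/andP[ip av]|[ip av]]; first by split=> //; apply/avoids_patP.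
by rewrite ip; apply/avoids_patP.
Qed.

Lemma related_exists sh r r' n m (t : 'S_m) (p : 'S_n) :
  p \in avoiding_involutions n (dsum (pat r) t) ->
  exists2 p', p' \in avoiding_involutions n (dsum (pat r') t) & related sh r r' t p p'.
Proof.
move=> /in_avoiding[ip av]; set L := board p t.
have dL : down_closed L := @board_down _ _ p t.
have bL : bounded_by n L := @board_bounded _ _ p t.
have sL : forall i j, L i j = L j i := board_sym p t.
have [P [Q g]] := avoids_growth dL (graph_matching p) av.
have [sP sQ] := growth_sym dL sL ip g.
have [p' [ip' ag1 ag2 [P' [Q' [g' eb]]]]] : exists p' : 'S_n, [/\ involution p',
    forall i : 'I_n, ~~ L i.+1 (p i).+1 -> p' i = p i,
    forall i : 'I_n, ~~ L i.+1 (p' i).+1 -> p' i = p i &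
    exists P' Q', growth r' L (graph p') P' Q' /\
      forall i j, border L i j ->
        P' i j = (if sh then bshiftP L P Q i j else P i j) /\
        Q' i j = (if sh then bshiftQ L P Q i j else Q i j)].
  case: sh.
    have [sbP sbQ] := bshift_sym dL sL g sP sQ.
    apply: (involution_of_border_path r' dL bL sL ip g (bshift_border_path dL sL g sP sQ) sbP sbQ).
    by move=> i j /andP[h _]; exact: (bshift_size dL g).
  exact: (involution_of_border_path r' dL bL sL ip g (growth_border_path dL g) sP sQ).
have s1 : forall i j, L i j -> board p' t i j by exact: board_stable.
have eL : L = board p' t.
  apply: functional_extensionality => i; apply: functional_extensionality => j.
  apply/idP/idP; first exact: s1.
  apply: board_stable => {i j} i h; apply/esym/ag2.
  by apply: contra h; exact: s1.
exists p'; last by split=> //; exists P, Q, P', Q'.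
apply/in_avoiding; split=> //; rewrite -eL; exact: growth_avoids g'.
Qed.

(** [p'] determines the board, then its border data, the data before the shift, and the points on
    the board; off the board [p1] and [p2] both agree with [p']. *)
Lemma related_inj sh r r' n m (t : 'S_m) (p1 p2 p' : 'S_n) :
  involution p1 -> involution p2 ->
  related sh r r' t p1 p' -> related sh r r' t p2 p' -> p1 = p2.
Proof.
move=> i1 i2 [e1 a1 c1 [P1 [Q1 [P1' [Q1' [g1 g1' b1]]]]]].
move=> [e2 a2 c2 [P2 [Q2 [P2' [Q2' [g2 g2' b2]]]]]].
rewrite -e1 in e2; rewrite {}e2 in a2 c2 g2 g2' b2.
set L := board p1 t in a1 c1 g1 g1' b1 a2 c2 g2 g2' b2.
have dL : down_closed L := @board_down _ _ p1 t.
have bL : bounded_by n L := @board_bounded _ _ p1 t.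
have sL : forall i j, L i j = L j i := board_sym p1 t.
have [sP1 sQ1] := growth_sym dL sL i1 g1; have [sP2 sQ2] := growth_sym dL sL i2 g2.
have eb' i j : border L i j -> P1' i j = P2' i j /\ Q1' i j = Q2' i j.
  by case/andP => h _; exact: (growth_forward_uniq dL g1' g2' h).
have eb i j : border L i j -> P1 i j = P2 i j /\ Q1 i j = Q2 i j.
  case: sh b1 b2 => b1 b2; last first.
    by move=> b; have [<- <-] := b1 _ _ b; have [<- <-] := b2 _ _ b; exact: eb'.
  apply: (bshift_inj dL bL sL g1 sP1 sQ1 g2 sP2 sQ2) => {}i {}j b.
  by have [<- <-] := b1 _ _ b; have [<- <-] := b2 _ _ b; exact: eb'.
have [_ eX] := growth_backward_uniq dL bL g1 g2 eb.
apply/permP => i; have [h|h] := boolP (L i.+1 (p1 i).+1).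
  by apply/val_inj/esym; have := eX _ _ h; rewrite !graph_ord eqxx => /esym/eqP.
by rewrite -(a1 _ h) -c2 // (a1 _ h).
Qed.

Lemma related_peak n m (t : 'S_m) (p p' : 'S_n) :
  involution p -> involution p' -> related true true false t p p' -> Peak p = Peak p'.
Proof.
move=> ip ip' [eL ag1 ag2 [P [Q [P' [Q' [g g' eb]]]]]].
set L := board p t in eL ag1 ag2 g g' eb.
have dL : down_closed L := @board_down _ _ p t.
have sL : forall i j, L i j = L j i := board_sym p t.
have [sP sQ] := growth_sym dL sL ip g.
have inE' i : inside p t i = inside p' t i.
  rewrite /inside -eL -/L.
  apply/idP/idP => h; apply: contraT => h'; last by rewrite (ag1 _ h') (negbTE h') in h.
  by have e := ag2 _ h'; rewrite e h in h'.
have out i : ~~ inside p t i -> p' i = p i by exact: ag1.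
suff main (a i b : 'I_n) : i = a.+1 :> nat -> b = i.+1 :> nat ->
    (p a < p i) && (p b < p i) = (p' a < p' i) && (p' b < p' i).
  apply/setP => i; rewrite !inE; apply: eq_existsb => a; apply: eq_existsb => b.
  by case: eqP => // ei; case: eqP => // eb'; rewrite /= main.
move=> ai ib.
(* For [i] off the board, comparison with a neighbour on the board is forced, and with one off the
   board it involves unchanged values. *)
have [ii|ni] := boolP (inside p t i); last first.
  have ni' : ~~ inside p' t i by rewrite -inE'.
  have ea : (p a < p i) = (p' a < p' i).
    have [ia|na] := boolP (inside p t a); last by rewrite (out _ na) (out _ ni).
    have ia' : inside p' t a by rewrite -inE'.
    by rewrite (ascent_out_of ip ai ia ni) (ascent_out_of ip' ai ia' ni').
  have ed : (p b < p i) = (p' b < p' i).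
    have [jb|nb] := boolP (inside p t b); last by rewrite (out _ nb) (out _ ni).
    have jb' : inside p' t b by rewrite -inE'.
    by rewrite (descent_into ib ni jb) (descent_into ib ni' jb').
  by rewrite ea ed.
have ii' : inside p' t i by rewrite -inE'.
(* If a neighbour is off the board, then [i] is below it in both permutations and is no peak. *)
have [ia|na] := boolP (inside p t a); last first.
  have na' : ~~ inside p' t a by rewrite -inE'.
  have := descent_into ai na ii; have := descent_into ai na' ii'.
  by lia.
have ia' : inside p' t a by rewrite -inE'.
have [jb|nb] := boolP (inside p t b); last first.
  have nb' : ~~ inside p' t b by rewrite -inE'.
  have := ascent_out_of ip ib ii nb; have := ascent_out_of ip' ib ii' nb'.
  by lia.
have jb' : inside p' t b by rewrite -inE'.
(* All three columns now have the same height, so they lie in one run. *)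
have [h [_ Lah nLah]] := board_height ia.
have [Lih nLih] := inside_same_height ip ai ia ii Lah nLah.
have [Lbh nLbh] := inside_same_height ip ib ii jb Lih nLih.
have low (c q : 'I_n) : L c.+1 q.+1 -> ~~ L c.+1 h.+1 -> q < h.
  by move=> Lq; rewrite ltnNge; apply: contra => hq; apply: dL Lq.
have pa : p a < h by exact: low ia nLah.
have pi : p i < h by exact: low ii nLih.
have pb : p b < h by exact: low jb nLbh.
have pa' : p' a < h by apply: low nLah; rewrite eL.
have pi' : p' i < h by apply: low nLih; rewrite eL.
have pb' : p' b < h by apply: low nLbh; rewrite eL.
have gr (c : 'I_n) (q : 'S_n) : graph q c (q c) by rewrite graph_ord.
have de : (p b < p i) = (P a.+1 h < P a.+2 h) && (Q a.+2 h < Q a.+3 h).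
  rewrite -ai; apply: (rows_descent (x := p i) (y := p b) dL g) => //; first by rewrite -ib.
  by rewrite -ib; exact: gr.
have as' : (p' a < p' i) = (P' a h < P' a.+1 h) && (Q' a.+1 h < Q' a.+2 h).
  apply: (cols_ascent (x := p' a) (y := p' i) dL g') => //; first by rewrite -ai.
  by rewrite -ai; exact: gr.
(* Two descents in a row would form a 321, so a peak is just a descent from [i]; dually, for [p'] it
   is just an ascent to [i]. *)
have -> : (p a < p i) && (p b < p i) = (p b < p i).
  apply: andb_idl => bi; case: (ltngtP (p a) (p i)) => // [ia_|e].
    have c1 : a < i < b by rewrite ib ai !leqnn.
    have c2 : p b < p i < p a by rewrite bi.
    have c3 : graph p a (p a) && graph p b (p b) by apply/andP; split; exact: gr.
    have /negP[] := growth_avoids dL g c1 c2 c3 (gr i p).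
    by apply: dL Lbh.
  have pe : p a = p i by apply/val_inj.
  by move: ai; rewrite (perm_inj pe) => /esym/eqP; rewrite (gtn_eqF (ltnSn _)).
have -> : (p' a < p' i) && (p' b < p' i) = (p' a < p' i).
  apply: andb_idr => bi; case: (ltngtP (p' b) (p' i)) => // [ib_|e].
    have c1 : a < i < b by rewrite ib ai !leqnn.
    have c2 : p' a < p' i < p' b by rewrite bi.
    have c3 : graph p' a (p' a) && graph p' b (p' b) by apply/andP; split; exact: gr.
    have /negP[] := growth_avoids dL g' c1 c2 c3 (gr i p').
    by apply: dL Lbh.
  have pe : p' b = p' i by apply/val_inj.
  by move: ib; rewrite (perm_inj pe) => /esym/eqP; rewrite (gtn_eqF (ltnSn _)).
rewrite de as' {de as'}; rewrite ai in Lih nLih; rewrite ib ai in Lbh nLbh.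
have bd c : L c.+1 h -> ~~ L c.+1 h.+1 -> border L c h /\ border L c.+1 h.
  move=> h1 h2; rewrite /border h1 h2 (dL _ _ _ _ (leqnSn c) (leqnn h) h1).
  by split=> //; apply: contra h2; apply: dL.
have [b0 b1] := bd _ Lah nLah; have [_ b2] := bd _ Lih nLih.
have [-> _] := eb _ _ b0; have [-> ->] := eb _ _ b1; have [_ ->] := eb _ _ b2.
have [-> _ -> ->] := bshift_row dL sL g sP sQ Lah nLah.
have [_ _ _ ->] := bshift_row dL sL g sP sQ Lih nLih.
have run (c : 'I_n) : L c.+1 h -> ~~ L c.+1 h.+1 -> p c < h -> in_run L P Q h c.
  move=> h1 h2 pc; rewrite /in_run h1 h2 (growth_size_col dL g h1).
  have -> : has (graph p c) (iota 0 h) by apply/hasP; exists (p c : nat); rewrite ?mem_iota ?gr.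
  by rewrite addn1 leqnn.
apply: (shift_peak (in_run_path dL g (j := h))).
- exact: run.
- by rewrite -ai; apply: run; rewrite ?ai.
- by rewrite -ai -ib; apply: run; rewrite ?ib ?ai.
Qed.

Theorem theorem1p8 (n : nat) (hn : 1 <= n) (m : nat) (tau : 'S_m) :
  exists Phi :
    {p : 'S_n | p \in avoiding_involutions n (dsum pat123 tau)} ->
    {p : 'S_n | p \in avoiding_involutions n (dsum pat321 tau)},
    bijective Phi /\ forall p, Peak (val p) = Peak (val (Phi p)).
Proof.
pose A r := {p : 'S_n | p \in avoiding_involutions n (dsum (pat r) tau)}.
have map sh r r' : exists F : A r -> A r', injective F /\
    forall p, related sh r r' tau (val p) (val (F p)).
  have ex (p : A r) : exists p' : A r', related sh r r' tau (val p) (val p').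
    have [p' hp' rel] := related_exists sh r' (valP p).
    by exists (exist _ p' hp').
  have [F hF] := fin_all_exists ex; exists F; split=> // p1 p2 e; apply: val_inj.
  have [i1 _] := (in_avoiding r tau _).1 (valP p1).
  have [i2 _] := (in_avoiding r tau _).1 (valP p2).
  by apply: (related_inj i1 i2 (hF p1)); rewrite e.
(* [F] shifts the border; [G] only bounds the cardinality, which makes [F] bijective. [Phi] is the
   inverse of [F]. *)
have [F [Finj Frel]] := map true true false.
have [G [Ginj _]] := map false false true.
have [Phi FK PhiK] := inj_card_bij Finj (leq_card _ Ginj).
exists Phi; split; first by exists F.
have ip r (q : A r) : involution (val q) by have [] := (in_avoiding r tau _).1 (valP q).
move=> p; have := related_peak (ip _ (Phi p)) (ip _ (F (Phi p))) (Frel (Phi p)).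
by rewrite PhiK => ->.
Qed.
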